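(* (i) Let $1<p<\infty$. The operator $C_1\in\mathcal{L}(ces_p)$ has norm $\|C_1\|_{ces_p\to ces_p}=p':=p/(p-1)$ and spectrum $$\sigma(C_1;ces_p)=\Big\{z\in\mathbb{C}:\ \Big|z-\frac{p'}2\Big|\le\frac{p'}2\Big\}.$$ Moreover, $C_1$ is not compact, not power bounded and not mean ergodic in $ces_p$ and fails to be supercyclic. (ii) For $p=0$ the operator $C_1\in\mathcal{L}(ces_0)$ has norm $\|C_1\|_{ces_0\to ces_0}=1$ and so it is power bounded. Its spectra are given by $$\sigma_{pt}(C_1;ces_0)=\emptyset\quad\text{and}\quad\sigma(C_1;ces_0)=\Big\{z\in\mathbb{C}:\ \Big|z-\frac12\Big|\le\frac12\Big\}.$$ Furthermore, $C_1$ is not compact, not mean ergodic and not supercyclic in $ces_0$. (iii) For $p=\infty$ the operator $C_1\in\mathcal{L}(ces_\infty)$ satisfies $\|C_1\|_{ces_\infty\to ces_\infty}=1$ and so it is power bounded. Moreover, $C_1$ is not compact and not mean ergodic in the non-separable space $ces_\infty$ and fails to be supercyclic.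
   Context: Sequences are complex and indexed by $\mathbb{N}_0=\{0,1,2,\dots\}$; $\omega=\mathbb{C}^{\mathbb{N}_0}$. $C_1x=\big(\frac{x_0+x_1+\dots+x_n}{n+1}\big)_{n\in\mathbb{N}_0}$. For $1<p<\infty$, $ces_p:=\{x\in\omega:\|x\|_{ces_p}:=\big(\sum_{n=0}^\infty(\frac1{n+1}\sum_{k=0}^n|x_k|)^p\big)^{1/p}<\infty\}$. $ces_\infty:=\{x\in\omega:\|x\|_{ces_\infty}:=\sup_n\frac1{n+1}\sum_{k=0}^n|x_k|<\infty\}$, and $ces_0$ is the closed subspace of those $x\in ces_\infty$ with $\frac1{n+1}\sum_{k=0}^n|x_k|\to0$ as $n\to\infty$, with the norm of $ces_\infty$. These are Banach spaces. $\mathcal{L}(X)$ is the space of bounded linear operators on $X$; $\sigma(T;X)$ and $\sigma_{pt}(T;X)$ are the spectrum and point spectrum (set of eigenvalues) of $T$. With $T_{[n]}:=\frac1n\sum_{m=1}^nT^m$, $T$ is mean ergodic if $(T_{[n]})_{n\geq 1}$ converges in the strong operator topology; power bounded if $\sup_{n\ge1}\|T^n\|<\infty$; supercyclic if there is $x\in X$ with $\{\lambda T^nx:\lambda\in\mathbb{C},n\in\mathbb{N}_0\}$ dense in $X$. *)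

(* Defs.v *)
From HB Require Import structures.
From mathcomp Require Import all_boot all_order all_algebra.
From mathcomp Require Import complex.
From mathcomp Require Import all_classical all_reals all_analysis.

Set Implicit Arguments.
Unset Strict Implicit.
Unset Printing Implicit Defensive.

Import Order.TTheory GRing.Theory Num.Theory.
Import numFieldNormedType.Exports.

Local Open Scope classical_set_scope.
Local Open Scope complex_scope.
Local Open Scope ring_scope.

(* Over the scalars R[i] the library norm `|x| takes its values in R[i];
   since `|x| >= 0, its real part carries the same information. *)
Definition rnorm (R : realType) (V : normedZmodType R[i]) (x : V) : R :=
  complex.Re `|x|.

Section rnorm_theory.
Context {R : realType} {V : normedZmodType R[i]}.
Implicit Types x y : V.

Lemma rnormE x : `|x| = (rnorm x)%:C.
Proof.
rewrite /rnorm; have := normr_ge0 x; case: `|x| => a b.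
by rewrite lecE /= => /andP[/eqP b0 _]; rewrite b0 complexr0.
Qed.

Lemma rnorm_ge0 x : 0 <= rnorm x.
Proof.
rewrite /rnorm; have := normr_ge0 x; case: `|x| => a b.
by rewrite lecE /= => /andP[].
Qed.

Lemma rnormD x y : rnorm (x + y) <= rnorm x + rnorm y.
Proof. by rewrite -lecR rmorphD /= -!rnormE; exact: ler_normD. Qed.

Lemma rnorm0 : rnorm (0 : V) = 0.
Proof. by rewrite /rnorm normr0. Qed.

Lemma rnorm0_eq0 x : rnorm x = 0 -> x = 0.
Proof. by move=> x0; apply/normr0_eq0; rewrite rnormE x0. Qed.

End rnorm_theory.

Lemma rnormM (R : realType) (a b : R[i]) : rnorm (a * b) = rnorm a * rnorm b.
Proof. by apply: complexI; rewrite rmorphM /= -!rnormE normrM. Qed.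

Section bounded_operators.
Variables (R : realType) (V : normedModType R[i]).

Record bounded_op := BoundedOp {
  bounded_op_fun :> {linear V -> V};
  bounded_op_bounded :
    exists M : R, forall x, rnorm (bounded_op_fun x) <= M * rnorm x }.

Definition opnorm (T : V -> V) : \bar R :=
  ereal_sup [set (rnorm (T x))%:E | x in [set x | rnorm x <= 1]].

Definition spectrum (T : bounded_op) : set R[i] :=
  [set z | ~ exists S : bounded_op,
     (forall x, S (z *: x - T x) = x) /\ (forall x, z *: S x - T (S x) = x)].

Definition point_spectrum (T : bounded_op) : set R[i] :=
  [set z | exists2 x, x != 0 & T x = z *: x].

Definition compact_op (T : bounded_op) : Prop :=
  precompact (T @` [set x | rnorm x <= 1]).

Definition power_bounded (T : bounded_op) : Prop :=
  (ereal_sup [set opnorm (iter n T) | n in [set n | (1 <= n)%N]] < +oo)%E.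

(* The value at n = 0 is the junk value 0; it does not affect the limit. *)
Definition ergodic_mean (T : V -> V) (n : nat) (x : V) : V :=
  n%:R^-1 *: \sum_(1 <= m < n.+1) iter m T x.

Definition mean_ergodic (T : bounded_op) : Prop :=
  exists P : bounded_op, forall x, ergodic_mean T n x @[n --> \oo] --> P x.

Definition supercyclic (T : bounded_op) : Prop :=
  exists x : V, dense [set y | exists (l : R[i]) (n : nat), y = l *: iter n T x].

End bounded_operators.

Definition separable (X : topologicalType) : Prop :=
  exists2 D : set X, countable D & dense D.

(* A linear subspace of the space of all complex sequences, with a norm on
   it; seqspace_norm is only meaningful on seqspace_dom. *)
Record seqspace (R : realType) := SeqSpace {
  seqspace_dom : set (nat -> R[i]);
  seqspace_norm : (nat -> R[i]) -> R;
  seqspace_dom0 : seqspace_dom 0;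
  seqspace_domD : forall x y,
    seqspace_dom x -> seqspace_dom y -> seqspace_dom (x + y);
  seqspace_domZ : forall (a : R[i]) x, seqspace_dom x -> seqspace_dom (a *: x);
  seqspace_normD : forall x y, seqspace_dom x -> seqspace_dom y ->
    seqspace_norm (x + y) <= seqspace_norm x + seqspace_norm y;
  seqspace_normZ : forall (a : R[i]) x, seqspace_dom x ->
    seqspace_norm (a *: x) = rnorm a * seqspace_norm x;
  seqspace_norm_eq0 : forall x,
    seqspace_dom x -> seqspace_norm x = 0 -> x = 0 }.

Section seqspace_normedMod.
Context {R : realType}.
Implicit Types E : seqspace R.

Definition seqspace_pred E : {pred nat -> R[i]} :=
  fun x => `[< seqspace_dom E x >].

Lemma seqspace_submod E : GRing.submod_closed (seqspace_pred E).
Proof.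
split=> [|a x y /asboolP xE /asboolP yE]; apply/asboolP.
  exact: seqspace_dom0.
by apply: seqspace_domD => //; exact: seqspace_domZ.
Qed.

HB.instance Definition _ E :=
  GRing.isSubmodClosed.Build _ _ (seqspace_pred E) (seqspace_submod E).

Definition seqspace_type E := {x : nat -> R[i] | x \in seqspace_pred E}.

HB.instance Definition _ E := SubChoice.on (seqspace_type E).
HB.instance Definition _ E :=
  [SubChoice_isSubLmodule of seqspace_type E by <:].

Lemma seqspace_valP E (x : seqspace_type E) : seqspace_dom E (val x).
Proof. by apply/asboolP; exact: (valP x). Qed.

Let nm E (x : seqspace_type E) : R[i] := (seqspace_norm E (val x))%:C.

Let nmD E (x y : seqspace_type E) : nm (x + y) <= nm x + nm y.
Proof.
rewrite /nm -rmorphD lecR /= ; apply: seqspace_normD; exact: seqspace_valP.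
Qed.

Let nmZ E (a : R[i]) (x : seqspace_type E) : nm (a *: x) = `|a| * nm x.
Proof.
by rewrite /nm rnormE -rmorphM /= seqspace_normZ//; exact: seqspace_valP.
Qed.

Let nm_eq0 E (x : seqspace_type E) : nm x = 0 -> x = 0.
Proof.
move=> /complexI x0; apply: val_inj.
by rewrite (seqspace_norm_eq0 (seqspace_valP x) x0).
Qed.

HB.instance Definition _ E :=
  Lmodule_isNormed.Build R[i] (seqspace_type E) (@nmD E) (@nmZ E) (@nm_eq0 E).

Lemma rnorm_seqspace E (x : seqspace_type E) :
  rnorm x = seqspace_norm E (val x).
Proof. by []. Qed.

End seqspace_normedMod.

Coercion seqspace_type : seqspace >-> Sortclass.


Section cesaro_spaces.
Context {R : realType}.
Implicit Types (x y : nat -> R[i]) (p : R).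

Definition cesaro x : nat -> R[i] :=
  fun n => (\sum_(k < n.+1) x k) / n.+1%:R.

Definition abs_mean x (n : nat) : R :=
  (\sum_(k < n.+1) rnorm (x k)) / n.+1%:R.

Definition ces_norm p x : \bar R :=
  ((\sum_(0 <= n <oo) (abs_mean x n `^ p)%:E) `^ p^-1)%E.

Definition ces_oo_norm x : \bar R :=
  ereal_sup (range (fun n => (abs_mean x n)%:E)).

Lemma abs_mean_ge0 x n : 0 <= abs_mean x n.
Proof.
by rewrite divr_ge0// sumr_ge0// => k _; exact: rnorm_ge0.
Qed.

Lemma abs_mean0 n : abs_mean 0 n = 0.
Proof. by rewrite /abs_mean big1 ?mul0r// => k _; exact: rnorm0. Qed.

Lemma abs_meanD x y n : abs_mean (x + y) n <= abs_mean x n + abs_mean y n.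
Proof.
rewrite /abs_mean -mulrDl ler_wpM2r ?invr_ge0// -big_split /=.
by apply: ler_sum => k _; exact: rnormD.
Qed.

Lemma abs_meanZ (a : R[i]) x n : abs_mean (a *: x) n = rnorm a * abs_mean x n.
Proof.
rewrite /abs_mean mulrA; congr (_ / _); rewrite mulr_sumr.
by apply: eq_bigr => k _; exact: rnormM.
Qed.

Lemma abs_mean_eq0 x : (forall n, abs_mean x n = 0) -> x = 0.
Proof.
move=> x0; apply/funext => n; apply: rnorm0_eq0; apply/eqP.
have /eqP := x0 n; rewrite mulf_eq0 invr_eq0 pnatr_eq0 orbF.
rewrite psumr_eq0 => [|k _]; last exact: rnorm_ge0.
by move=> /allP/(_ ord_max (mem_index_enum _)).
Qed.

Lemma ces_normE p x : 0 < p ->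
  ces_norm p x = Lnorm counting p%:E (EFin \o abs_mean x).
Proof.
move=> p0; rewrite Lnorm_counting// /ces_norm; congr poweR.
apply: eq_eseriesr => n _ /=.
by rewrite ger0_norm ?abs_mean_ge0.
Qed.

Lemma ces_norm_ge0 p x : (0 <= ces_norm p x)%E.
Proof. exact: poweR_ge0. Qed.

Lemma ces_norm_sum_ge0 p x : (0 <= \sum_(0 <= n <oo) (abs_mean x n `^ p)%:E)%E.
Proof. by apply: nneseries_ge0 => n _ _; rewrite lee_fin powR_ge0. Qed.

Lemma ces_norm0 p : 0 < p -> ces_norm p 0 = 0%E.
Proof.
move=> p0; rewrite /ces_norm eseries0 ?poweR0r ?invr_eq0 ?gt_eqF//.
by move=> n _ _; rewrite abs_mean0 powR0// gt_eqF.
Qed.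

Lemma ces_normD p x y : 1 < p ->
  (ces_norm p (x + y)%R <= ces_norm p x + ces_norm p y)%E.
Proof.
move=> p1; have p0 : 0 < p by exact: lt_trans p1.
rewrite [ces_norm p x]ces_normE// [ces_norm p y]ces_normE//.
apply: le_trans (minkowski_EFin _ _ _ (ltW p1)) => //.
rewrite Lnorm_counting//; apply: gt0_ler_poweR.
- by rewrite invr_ge0 ltW.
- by rewrite in_itv /= leey ces_norm_sum_ge0.
- rewrite in_itv /= leey andbT.
  by apply: nneseries_ge0 => n _ _; rewrite lee_fin powR_ge0.
apply: lee_nneseries => n _; first by rewrite lee_fin powR_ge0.
rewrite /= lee_fin ger0_norm ?addr_ge0 ?abs_mean_ge0//.
apply: ge0_ler_powR; rewrite ?nnegrE ?addr_ge0 ?abs_mean_ge0 ?(ltW p0)//.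
exact: abs_meanD.
Qed.

Lemma ces_normZ p (a : R[i]) x : 0 < p ->
  ces_norm p (a *: x) = ((rnorm a)%:E * ces_norm p x)%E.
Proof.
move=> p0; have a0 := rnorm_ge0 a; rewrite /ces_norm.
under eq_eseriesr do rewrite abs_meanZ powRM ?abs_mean_ge0// EFinM.
rewrite nneseriesZl; last by move=> n _; rewrite lee_fin powR_ge0.
rewrite poweRM ?lee_fin ?powR_ge0 ?ces_norm_sum_ge0//.
by rewrite poweR_EFin -powRrM divff ?gt_eqF// powRr1.
Qed.

Lemma ces_norm_eq0 p x : 0 < p -> ces_norm p x = 0%E -> x = 0.
Proof.
move=> p0 /poweR_eq0_eq0 s0; apply: abs_mean_eq0 => n.
have : (\sum_(0 <= n <oo) (abs_mean x n `^ p)%:E = 0)%E.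
  by apply: s0; exact: ces_norm_sum_ge0.
move=> s00; have : ((abs_mean x n `^ p)%:E <= 0)%E.
  rewrite -s00.
  apply: le_trans (nneseries_lim_ge n.+1 _); last first.
    by move=> k _ _; rewrite lee_fin powR_ge0.
  rewrite big_nat_recr//= leeDr// sume_ge0// => k _.
  by rewrite lee_fin powR_ge0.
rewrite lee_fin => m0; have : abs_mean x n `^ p == 0.
  by rewrite eq_le m0 powR_ge0.
by rewrite powR_eq0 => /andP[/eqP].
Qed.

Lemma abs_mean_le_ces_oo x n : ((abs_mean x n)%:E <= ces_oo_norm x)%E.
Proof. by apply: ereal_sup_ubound; exists n. Qed.

Lemma ces_oo_norm_ge0 x : (0 <= ces_oo_norm x)%E.
Proof.
by apply: le_trans (abs_mean_le_ces_oo x 0); rewrite lee_fin abs_mean_ge0.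
Qed.

Lemma ces_oo_norm0 : ces_oo_norm 0 = 0%E.
Proof.
apply/eqP; rewrite eq_le ces_oo_norm_ge0 andbT.
by apply: ge_ereal_sup => _ [n _ <-]; rewrite abs_mean0.
Qed.

Lemma ces_oo_normD x y :
  (ces_oo_norm (x + y)%R <= ces_oo_norm x + ces_oo_norm y)%E.
Proof.
apply: ge_ereal_sup => _ [n _ <-].
apply: (@le_trans _ _ ((abs_mean x n)%:E + (abs_mean y n)%:E)%E).
  by rewrite -EFinD lee_fin abs_meanD.
by apply: leeD; exact: abs_mean_le_ces_oo.
Qed.

Lemma ces_oo_normZ (a : R[i]) x :
  ces_oo_norm (a *: x) = ((rnorm a)%:E * ces_oo_norm x)%E.
Proof.
rewrite /ces_oo_norm -ereal_supZl ?rnorm_ge0//; last first.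
  by apply/set0P; exists (abs_mean x 0)%:E; exists 0%N.
rewrite image_comp; congr (ereal_sup _); apply: eq_imagel => n _ /=.
by rewrite abs_meanZ EFinM.
Qed.

Lemma ces_oo_norm_eq0 x : ces_oo_norm x = 0%E -> x = 0.
Proof.
move=> x0; apply: abs_mean_eq0 => n; apply/eqP.
rewrite eq_le abs_mean_ge0 andbT -lee_fin.
by have := abs_mean_le_ces_oo x n; rewrite x0.
Qed.

End cesaro_spaces.

Section cesaro_seqspaces.
Context {R : realType}.
Implicit Types x y : nat -> R[i].

Section ces.
Variables (p : R) (p1 : 1 < p).

Let p0 : 0 < p. Proof. exact: lt_trans p1. Qed.

Let fin x : (ces_norm p x < +oo)%E -> ces_norm p x \is a fin_num.
Proof. by rewrite ge0_fin_numE// ces_norm_ge0. Qed.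

Let dom0 : (ces_norm p (0%R : nat -> R[i]) < +oo)%E.
Proof. by rewrite ces_norm0. Qed.

Let domD x y : (ces_norm p x < +oo)%E -> (ces_norm p y < +oo)%E ->
  (ces_norm p (x + y)%R < +oo)%E.
Proof.
by move=> xoo yoo; apply: le_lt_trans (ces_normD _ _ p1) _; rewrite lte_add_pinfty.
Qed.

Let domZ (a : R[i]) x : (ces_norm p x < +oo)%E ->
  (ces_norm p (a *: x)%R < +oo)%E.
Proof.
by move=> xoo; rewrite ces_normZ// lte_mul_pinfty// lee_fin rnorm_ge0.
Qed.

Let normD x y : (ces_norm p x < +oo)%E -> (ces_norm p y < +oo)%E ->
  fine (ces_norm p (x + y)) <= fine (ces_norm p x) + fine (ces_norm p y).
Proof.
move=> xoo yoo; rewrite -fineD ?fin//; apply: fine_le; rewrite ?fin_numD ?fin//.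
  exact: domD.
exact: ces_normD.
Qed.

Let normZ (a : R[i]) x : (ces_norm p x < +oo)%E ->
  fine (ces_norm p (a *: x)) = rnorm a * fine (ces_norm p x).
Proof. by move=> xoo; rewrite ces_normZ// fineM ?fin. Qed.

Let norm_eq0 x : (ces_norm p x < +oo)%E -> fine (ces_norm p x) = 0 -> x = 0.
Proof.
by move=> xoo x0; apply: (ces_norm_eq0 p0); rewrite -(fineK (fin xoo)) x0.
Qed.

Definition ces : seqspace R := @SeqSpace R
  [set x | ces_norm p x < +oo]%E (fun x => fine (ces_norm p x))
  dom0 domD domZ normD normZ norm_eq0.

End ces.

Let fin x : (ces_oo_norm x < +oo)%E -> ces_oo_norm x \is a fin_num.
Proof. by rewrite ge0_fin_numE// ces_oo_norm_ge0. Qed.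

Let oo_dom0 : (ces_oo_norm (0%R : nat -> R[i]) < +oo)%E.
Proof. by rewrite ces_oo_norm0. Qed.

Let oo_domD x y : (ces_oo_norm x < +oo)%E -> (ces_oo_norm y < +oo)%E ->
  (ces_oo_norm (x + y)%R < +oo)%E.
Proof.
by move=> xoo yoo; apply: le_lt_trans (ces_oo_normD _ _) _; rewrite lte_add_pinfty.
Qed.

Let oo_domZ (a : R[i]) x : (ces_oo_norm x < +oo)%E ->
  (ces_oo_norm (a *: x)%R < +oo)%E.
Proof.
by move=> xoo; rewrite ces_oo_normZ lte_mul_pinfty// lee_fin rnorm_ge0.
Qed.

Let oo_normD x y : (ces_oo_norm x < +oo)%E -> (ces_oo_norm y < +oo)%E ->
  fine (ces_oo_norm (x + y)) <= fine (ces_oo_norm x) + fine (ces_oo_norm y).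
Proof.
move=> xoo yoo; rewrite -fineD ?fin//; apply: fine_le; rewrite ?fin_numD ?fin//.
  exact: oo_domD.
exact: ces_oo_normD.
Qed.

Let oo_normZ (a : R[i]) x : (ces_oo_norm x < +oo)%E ->
  fine (ces_oo_norm (a *: x)) = rnorm a * fine (ces_oo_norm x).
Proof. by move=> xoo; rewrite ces_oo_normZ fineM ?fin. Qed.

Let oo_norm_eq0 x : (ces_oo_norm x < +oo)%E ->
  fine (ces_oo_norm x) = 0 -> x = 0.
Proof.
by move=> xoo x0; apply: ces_oo_norm_eq0; rewrite -(fineK (fin xoo)) x0.
Qed.

Definition ces_oo : seqspace R := @SeqSpace R
  [set x | ces_oo_norm x < +oo]%E (fun x => fine (ces_oo_norm x))
  oo_dom0 oo_domD oo_domZ oo_normD oo_normZ oo_norm_eq0.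

Let dom_c0 : set (nat -> R[i]) :=
  [set x | (ces_oo_norm x < +oo)%E /\ abs_mean x @ \oo --> (0 : R)].

Let c0_dom0 : dom_c0 0.
Proof.
split=> //; rewrite (_ : abs_mean 0 = cst 0); first exact: cvg_cst.
by apply/funext => n; rewrite abs_mean0.
Qed.

Let c0_domD x y : dom_c0 x -> dom_c0 y -> dom_c0 (x + y).
Proof.
move=> [xoo x0] [yoo y0]; split; first exact: oo_domD.
apply: (@squeeze_cvgr _ _ _ _ (cst 0) (abs_mean x + abs_mean y)).
- by apply: nearW => n; rewrite abs_mean_ge0 abs_meanD.
- exact: cvg_cst.
- by rewrite -(addr0 (0 : R)); exact: cvgD.
Qed.

Let c0_domZ (a : R[i]) x : dom_c0 x -> dom_c0 (a *: x).
Proof.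
move=> [xoo x0]; split; first exact: oo_domZ.
rewrite (_ : abs_mean (a *: x) = fun n => rnorm a * abs_mean x n).
  by rewrite -(mulr0 (rnorm a)); exact: cvgMl_tmp.
by apply/funext => n; rewrite abs_meanZ.
Qed.

Definition ces_0 : seqspace R := @SeqSpace R
  [set x | (ces_oo_norm x < +oo)%E /\ abs_mean x @ \oo --> (0 : R)]
  (fun x => fine (ces_oo_norm x)) c0_dom0 c0_domD c0_domZ
  (fun x y xd yd => oo_normD xd.1 yd.1) (fun a x xd => oo_normZ a xd.1)
  (fun x xd => oo_norm_eq0 xd.1).

End cesaro_seqspaces.

Definition is_cesaro_op (R : realType) (E : seqspace R) (T : bounded_op E) :=
  forall x : E, val (T x) = cesaro (val x).

(* Main.v *)
Require Import Defs.
From HB Require Import structures.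
From mathcomp Require Import all_boot all_order all_algebra.
From mathcomp Require Import complex.
From mathcomp Require Import all_classical all_reals all_analysis.
From mathcomp Require Import ring lra zify.

Set Implicit Arguments.
Unset Strict Implicit.
Unset Printing Implicit Defensive.

Import Order.TTheory GRing.Theory Num.Theory.
Import numFieldNormedType.Exports.

Local Open Scope classical_set_scope.
Local Open Scope complex_scope.
Local Open Scope ring_scope.

(* Write [rho] for the norm of [C_1] on the space ([p'], or 1 in the sup case);
   [|C_1| <= rho] is Hardy's inequality, applied to the means of [|x|].
   For [Re w > 1/rho] the vector [y_k = prod_(j <= k) (1 - w/j) = O(k^(-s))],
   [1/rho < s < Re w], represents a bounded eigenfunctional for the eigenvalue
   [1/w]. Testing it on [e_0] gives [|C_1^n e_0| >= c |w|^(-n)], hence the norm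
   and the failure of power boundedness, and excludes a bounded inverse of
   [z - C_1] for [z] in the open disc; perturbing [z] covers the boundary.
   Outside the disc, with [w = 1/z] and [a] in ]max(Re w, 0), 1/rho[, the
   recursion solving [z y - C_1 y = x] is dominated by the one solving
   [v/a - C_1 v = |x|], and [v] is bounded through its truncations [u], which
   satisfy [u <= a (|x| + C_1 u)].
   The functionals [x_0] and [x_0 - x_1], with eigenvalues 1 and 1/2, forbid
   supercyclicity; the normalized unit vectors forbid compactness; the only
   possible limit of the ergodic means of [e_0] is the constant sequence 1. *)

(** * Hardy's inequality and power weights *)

Section real_inequalities.
Context {R : realType}.
Implicit Types (a b c : nat -> R) (p s t u v : R).

Definition mean a (n : nat) : R := (\sum_(k < n.+1) a k) / n.+1%:R.

Lemma mean_ge0 a n : (forall k, 0 <= a k) -> 0 <= mean a n.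
Proof. by move=> a0; rewrite divr_ge0// sumr_ge0. Qed.

Lemma le_mean a b n : (forall k, (k <= n)%N -> a k <= b k) ->
  mean a n <= mean b n.
Proof.
move=> ab; rewrite ler_wpM2r ?invr_ge0//.
by apply: ler_sum => k _; apply: ab; rewrite -ltnS.
Qed.

Lemma sum_mean a n : \sum_(k < n.+1) a k = n.+1%:R * mean a n.
Proof. by rewrite mulrC divfK. Qed.

Lemma cvg_mean a (l : R) : a @ \oo --> l -> mean a @ \oo --> l.
Proof.
move=> /sequences.cesaro; rewrite (_ : arithmetic_mean a = mean a)//.
apply/funext => n; rewrite /arithmetic_mean /mean mulrC seriesEnat/=.
by rewrite big_mkord.
Qed.

Lemma powR_mulB1 p u : 1 < p -> 0 <= u -> u `^ (p - 1) * u = u `^ p.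
Proof.
move=> p1 u0; rewrite -{2}(powRr1 u0) -powRD; last by rewrite subrK; apply/implyP; lra.
by rewrite subrK.
Qed.

(** [conjugate_powR] for the exponents [p / (p - 1)] and [p], taken at [u^(p-1)] and [v]. *)
Lemma young p u v : 1 < p -> 0 <= u -> 0 <= v ->
  u `^ (p - 1) * v <= (1 - p^-1) * u `^ p + v `^ p / p.
Proof.
move=> p1 u0 v0; have p0 : 0 < p by lra.
have pB0 : p - 1 != 0 by lra.
have -> : u `^ p = (u `^ (p - 1)) `^ (p / (p - 1)).
  by rewrite -powRrM; congr powR; field.
apply: (le_trans (@conjugate_powR _ _ _ (p / (p - 1)) p _ _ _ _ _)) => //.
- exact: powR_ge0.
- by rewrite divr_gt0//; lra.
- by rewrite invf_div; field; lra.
- by rewrite lerD2r mulrC ler_wpM2r ?powR_ge0// invf_div le_eqVlt; apply/orP; left;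
    apply/eqP; field; lra.
Qed.

(* Elliott's proof: with [A = mean a] and [a n = (n+1) A n - n A (n-1)],
   Young's inequality bounds [A n ^ p - q (A n) ^ (p-1) (a n)] by a
   telescoping term. *)
Lemma elliott p a N : 1 < p -> (forall k, 0 <= a k) ->
  \sum_(n < N) mean a n `^ p <=
  p / (p - 1) * \sum_(n < N) mean a n `^ (p - 1) * a n.
Proof.
move=> p1 a0; have pB0 : 0 < p - 1 by lra.
case: N => [|N]; first by rewrite !big_ord0 mulr0.
have A0 n : 0 <= mean a n by exact: mean_ge0.
suff: \sum_(n < N.+1) mean a n `^ p + N.+1%:R / (p - 1) * mean a N `^ p <=
      p / (p - 1) * \sum_(n < N.+1) mean a n `^ (p - 1) * a n.
  by apply: le_trans; rewrite lerDl mulr_ge0 ?powR_ge0// divr_ge0// ltW.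
elim: N => [|N IH].
  rewrite !big_ord_recl !big_ord0 !addr0 /= /mean big_ord1 divr1 powR_mulB1//.
  by rewrite le_eqVlt; apply/orP; left; apply/eqP; field; lra.
rewrite big_ord_recr [in leRHS]big_ord_recr /=.
have aE : a N.+1 = N.+2%:R * mean a N.+1 - N.+1%:R * mean a N.
  by rewrite -!sum_mean big_ord_recr/= [_ + a _]addrC addrK.
rewrite aE; set S1 := \sum_(n < _) _ in IH *; set S2 := \sum_(n < _) _ in IH *.
have X := powR_mulB1 p1 (A0 N.+1).
have := young p1 (A0 N.+1) (A0 N).
move: X; set X := _ `^ p; set Z := _ `^ (p - 1); set Y := mean a N `^ p in IH *.
set A := mean a N; set A' := mean a N.+1 => XE YZ.
have {YZ}: N.+1%:R * (p / (p - 1) * (Z * A)) <= N.+1%:R * (X + (p - 1)^-1 * Y).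
  apply: ler_wpM2l => //.
  have -> : X + (p - 1)^-1 * Y = p / (p - 1) * ((1 - p^-1) * X + Y / p).
    by field; lra.
  by rewrite ler_wpM2l// divr_ge0; lra.
have -> : Z * (N.+2%:R * A' - N.+1%:R * A) = N.+2%:R * X - N.+1%:R * (Z * A).
  by rewrite -XE; ring.
have N2 : N.+2%:R = N.+1%:R + 1 :> R by rewrite natr1.
move: IH; rewrite N2; move: (N.+1%:R : R) => W IH YZ.
rewrite mulrDr; apply: (le_trans _ (lerD IH (lexx _))).
rewrite -!addrA lerD2l.
suff : X + (W + 1) / (p - 1) * X = p / (p - 1) * (W + 1) * X - W * X by lra.
by field; lra.
Qed.

(** Young's inequality with [v = q * a n] bounds the right-hand side of [elliott] by the fraction
    [1 - p^-1] of its left-hand side plus a term in [a n ^ p]; the fraction is then absorbed on the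
    left. *)
Lemma hardy p a N : 1 < p -> (forall k, 0 <= a k) ->
  \sum_(n < N) mean a n `^ p <= (p / (p - 1)) `^ p * \sum_(n < N) a n `^ p.
Proof.
move=> p1 a0; have p0 : 0 < p by lra.
have q0 : 0 <= p / (p - 1) by rewrite divr_ge0; lra.
set q := p / (p - 1) in q0 *.
have : q * \sum_(n < N) mean a n `^ (p - 1) * a n <=
    (1 - p^-1) * (\sum_(n < N) mean a n `^ p) +
    (q `^ p * \sum_(n < N) a n `^ p) / p.
  rewrite !mulr_sumr mulr_suml -big_split/=.
  apply: ler_sum => n _; rewrite mulrCA -powRM// young ?mean_ge0//.
  exact: mulr_ge0.
move=> /(le_trans (elliott N p1 a0)).
by rewrite mulrBl mul1r -addrA lerDl addrC subr_ge0 mulrC ler_pM2r ?invr_gt0.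
Qed.

Lemma sum_subseq_le a (f : nat -> nat) N : (forall k, 0 <= a k) ->
  {homo f : m n / (m < n)%N} ->
  \sum_(n < N) a (f n) <= \sum_(n < f N) a n.
Proof.
move=> a0 fh; elim: N => [|N IH]; first by rewrite big_ord0 sumr_ge0.
rewrite big_ord_recr/=; apply: (@le_trans _ _ (\sum_(n < (f N).+1) a n)).
  by rewrite big_ord_recr/= lerD2r.
have /subnKC <- : ((f N).+1 <= f N.+1)%N by exact: fh.
by rewrite big_split_ord/= lerDl sumr_ge0.
Qed.

(** Bernoulli's inequality for a negative exponent, from [ln (1 - t) <= - t] and
    [1 + u <= expR u]. *)
Lemma powR_succ_ge t s : 0 <= t < 1 -> 0 <= s -> 1 + s * t <= (1 - t) `^ (- s).
Proof.
move=> /andP[t0 t1] s0; have h : 1 - t != 0 by lra.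
rewrite /powR (negbTE h); apply: le_trans (expR_ge1Dx _).
rewrite lerD2l mulNr -mulrN ler_wpM2l//.
by rewrite lerNr -[1 - t]/(1 + - t) le_ln1Dx//; lra.
Qed.

(** Discrete integral comparison: the partial sum plus the tail [(s - 1)^-1 (N + 1)^(1 - s)] stays
    below [1 + (s - 1)^-1], each step being [powR_succ_ge] at [t = 1 / (N + 2)] with exponent
    [s - 1]. *)
Lemma sum_powRN_le s : 1 < s ->
  exists K : R, forall N, \sum_(n < N) n.+1%:R `^ (- s) <= K.
Proof.
move=> s1; exists (1 + (s - 1)^-1) => -[|N].
  by rewrite big_ord0 addr_ge0// invr_ge0; lra.
suff: \sum_(n < N.+1) n.+1%:R `^ (- s) <=
      1 + (s - 1)^-1 - (s - 1)^-1 * N.+1%:R `^ (1 - s).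
  move=> /le_trans; apply; rewrite gerBl mulr_ge0 ?powR_ge0// invr_ge0; lra.
elim: N => [|N IH]; first by rewrite big_ord1 !powR1; lra.
rewrite big_ord_recr/=; apply: le_trans (lerD IH (lexx _)) _.
rewrite -addrA lerD2l -subr_ge0.
have sB0 : s - 1 != 0 by lra.
set A := N.+1%:R `^ _; set B := N.+2%:R `^ _; set D := N.+2%:R `^ _.
have NE : N.+1%:R = N.+2%:R * (1 - N.+2%:R^-1) :> R.
  by rewrite mulrBr divff// mulr1 -[N.+2%:R]natr1 addrK.
have n0 : 0 < N.+2%:R :> R by [].
have n1 : 0 <= (N.+2%:R^-1 : R) < 1 by rewrite invr_ge0 ler0n invf_lt1// ltr1n.
have /andP[_ n2] := n1.
have BE : B = N.+2%:R * D.
  rewrite /B /D -[1 - s]/(1 + - s) powRD ?pnatr_eq0 ?implybT//.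
  by rewrite powRr1.
have AE : A = B * (1 - N.+2%:R^-1) `^ (- (s - 1)).
  rewrite /A NE powRM//; first by rewrite opprB.
  by rewrite subr_ge0 ltW.
have : B * (1 + (s - 1) * N.+2%:R^-1) <= A.
  by rewrite AE ler_wpM2l ?powR_ge0// powR_succ_ge//; lra.
rewrite mulrDr mulr1 BE mulrCA mulrAC divff// mul1r -BE => h.
have -> : - ((s - 1)^-1 * B) - (- ((s - 1)^-1 * A) + D) =
  (s - 1)^-1 * (A - (B + (s - 1) * D)) by field.
by rewrite mulr_ge0 ?invr_ge0 ?subr_ge0//; lra.
Qed.

(** Each of the [k + 1] terms with [k <= n <= 2 k] is at least [(2 (k + 1))^(- s - 1)]. *)
Lemma dyadic_weight s k : 0 < s ->
  k.+1%:R `^ (- s) <=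
  2 `^ (s + 1) * \sum_(k <= n < k.*2.+1) n.+1%:R `^ (- s) / n.+1%:R.
Proof.
move=> s0.
have h n : (k <= n < k.*2.+1)%N ->
    (2 * k.+1%:R) `^ (- s) / (2 * k.+1%:R) <= n.+1%:R `^ (- s) / n.+1%:R :> R.
  move=> /andP[kn nk]; have nk2 : n.+1%:R <= 2 * k.+1%:R :> R.
    by rewrite -natrM ler_nat; lia.
  apply: ler_pM; rewrite ?powR_ge0 ?invr_ge0//; last by rewrite lef_pV2// posrE.
  rewrite !powRN lef_pV2 ?posrE ?powR_gt0//.
  by apply: ge0_ler_powR; rewrite ?nnegrE//; lra.
have := ler_sum_nat h; rewrite big_const_nat iter_addr addr0.
rewrite subSn -?addnn ?leq_addr// addnK powRM// => /(ler_wpM2l (powR_ge0 2 (s + 1))).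
apply: le_trans; rewrite le_eqVlt; apply/orP; left; apply/eqP.
rewrite powRD ?pnatr_eq0 ?implybT// powRr1// !powRN -[X in _ * X]mulr_natl.
have : 2 `^ s != 0 :> R by rewrite gt_eqF// powR_gt0.
have : k.+1%:R `^ s != 0 :> R by rewrite gt_eqF// powR_gt0.
have : k.+1%:R != 0 :> R by [].
move: (k.+1%:R : R) (k.+1%:R `^ s) (2 `^ s) => k' X Y k0 X0 Y0.
by field; apply/and3P.
Qed.

(** Passes from entries to means, which the norms control. After [dyadic_weight] the two sums are
    exchanged: the index [n] collects the [a k] with [k <= n], whose sum is at most [n + 1] times
    the mean. The blocks of all [k < N] end below [2 N]. *)
Lemma weighted_sum_le a s N : (forall k, 0 <= a k) -> 0 < s ->
  \sum_(k < N) a k * k.+1%:R `^ (- s) <=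
  2 `^ (s + 1) * \sum_(n < N.*2) mean a n * n.+1%:R `^ (- s).
Proof.
move=> a0 s0; pose w n := n.+1%:R `^ (- s) / n.+1%:R : R.
have w0 n : 0 <= w n by rewrite divr_ge0// powR_ge0.
apply: (@le_trans _ _ (\sum_(k < N) \sum_(n < N.*2)
    2 `^ (s + 1) * (if (k <= n)%N then a k * w n else 0))).
  apply: ler_sum => k _; rewrite -mulr_sumr -big_mkcond/= -mulr_sumr mulrCA.
  rewrite ler_wpM2l//; apply: le_trans (dyadic_weight k s0) _.
  rewrite ler_wpM2l ?powR_ge0// [leRHS]big_mkcond/=.
  rewrite -(big_mkord xpredT (fun n => if (k <= n)%N then w n else 0)).
  have kN : (k.*2.+1 <= N.*2)%N by have := ltn_ord k; lia.
  rewrite [leRHS](@big_cat_nat _ _ _ k)//=; last by lia.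
  rewrite [X in _ + X](@big_cat_nat _ _ _ k.*2.+1)//=; last by lia.
  have F0 n : 0 <= (if (k <= n)%N then w n else 0) by case: ifP.
  apply: ler_wpDl; first exact: sumr_ge0.
  apply: ler_wpDr; first exact: sumr_ge0.
  by rewrite le_eqVlt; apply/orP; left; apply/eqP/eq_big_nat => n /andP[-> _].
rewrite exchange_big/= mulr_sumr; apply: ler_sum => n _.
rewrite -mulr_sumr ler_wpM2l ?powR_ge0// -big_mkcond/= -mulr_suml.
rewrite /mean mulrAC -mulrA ler_wpM2r//.
have [nN|Nn] := leqP n.+1 N; first by rewrite (big_ord_narrow nN).
rewrite -(subnKC (ltnW Nn)) big_split_ord/=; apply: ler_wpDr; first exact: sumr_ge0.
by rewrite [leLHS]big_mkcond/=; apply: ler_sum => k _; case: ifP.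
Qed.

End real_inequalities.

(** * Real-valued norms, density and compactness *)

Section rnorm_lemmas.
Context {R : realType}.

Lemma rnormZ (V : normedModType R[i]) (a : R[i]) (x : V) :
  rnorm (a *: x) = rnorm a * rnorm x.
Proof. by apply: complexI; rewrite rmorphM /= -!rnormE normrZ. Qed.

Lemma rnormN (V : normedZmodType R[i]) (x : V) : rnorm (- x) = rnorm x.
Proof. by rewrite /rnorm normrN. Qed.

Lemma rdistC (V : normedZmodType R[i]) (x y : V) : rnorm (x - y) = rnorm (y - x).
Proof. by rewrite -rnormN opprB. Qed.

Lemma rnorm_sum (V : normedZmodType R[i]) I (r : seq I) (P : pred I) (F : I -> V) :
  rnorm (\sum_(i <- r | P i) F i) <= \sum_(i <- r | P i) rnorm (F i).
Proof.
elim/big_rec2: _ => [|i y x _ h]; first by rewrite rnorm0.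
by apply: le_trans (rnormD _ _) _; rewrite lerD2l.
Qed.

Lemma rnormC (r : R) : rnorm r%:C = `|r|.
Proof. by rewrite /rnorm normc_def/= expr0n/= addr0 sqrtr_sqr. Qed.

Lemma rnorm1 : rnorm (1 : R[i]) = 1.
Proof. by rewrite (rnormC 1) normr1. Qed.

Lemma natrC n : n%:R = (n%:R : R)%:C.
Proof. by rewrite rmorph_nat. Qed.

Lemma rnorm_nat n : rnorm (n%:R : R[i]) = n%:R.
Proof. by rewrite natrC rnormC ger0_norm. Qed.

Lemma rnorm_eq0 (a : R[i]) : (rnorm a == 0) = (a == 0).
Proof.
by apply/eqP/eqP => [|->]; [exact: rnorm0_eq0|exact: rnorm0].
Qed.

Lemma rnorm_gt0 (a : R[i]) : (0 < rnorm a) = (a != 0).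
Proof. by rewrite lt_neqAle rnorm_ge0 andbT eq_sym rnorm_eq0. Qed.

Lemma rnormV (a : R[i]) : rnorm a^-1 = (rnorm a)^-1.
Proof.
have [->|a0] := eqVneq a 0; first by rewrite invr0 rnorm0 invr0.
have n0 : rnorm a != 0 by rewrite rnorm_eq0.
by apply: (mulfI n0); rewrite -rnormM !divff// rnorm1.
Qed.

Lemma rnormX (a : R[i]) n : rnorm (a ^+ n) = rnorm a ^+ n.
Proof. by elim: n => [|n IH]; rewrite ?expr0 ?rnorm1// !exprS rnormM IH. Qed.

Lemma rnorm_le_dist (V : normedZmodType R[i]) (x y : V) :
  rnorm x <= rnorm (x - y) + rnorm y.
Proof. by rewrite -{1}(subrK y x); exact: rnormD. Qed.

Lemma Re_le_rnorm (a : R[i]) : complex.Re a <= rnorm a.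
Proof.
apply: le_trans (ler_norm _) _.
by have := normc_ge_Re a; rewrite rnormE lecR.
Qed.

Lemma rnorm_eps_eq0 (a : R[i]) (K : R) :
  (forall e, 0 < e -> rnorm a <= K * e) -> a = 0.
Proof.
move=> h; apply: rnorm0_eq0; apply/eqP; rewrite eq_le rnorm_ge0 andbT.
rewrite leNgt; apply/negP => a0.
have K0 : 0 < K.
  by have := h 1 ltr01; rewrite mulr1; exact: lt_le_trans.
have := h (rnorm a / (2 * K)); rewrite divr_gt0 ?mulr_gt0// => /(_ isT).
have -> : K * (rnorm a / (2 * K)) = rnorm a / 2 by field; rewrite gt_eqF.
lra.
Qed.

Variable V : normedModType R[i].

Lemma dense_rnorm (S : set V) (x : V) (e : R) :
  dense S -> 0 < e -> exists2 s, S s & rnorm (x - s) < e.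
Proof.
move=> /(_ (ball x e%:C)) dS e0.
have eC : 0 < e%:C by rewrite ltcR.
have [|s []] := dS _ (ball_open _ _); first by exists x; exact: ballxx.
by rewrite -ball_normE /= rnormE ltcR => h Ss; exists s.
Qed.

Lemma cvg_rnorm (u : nat -> V) (l : V) (e : R) :
  u n @[n --> \oo] --> l -> 0 < e -> \forall n \near \oo, rnorm (l - u n) < e.
Proof.
move=> /cvgrPdist_lt /(_ e%:C) h e0; move: h.
rewrite ltcR => /(_ e0); apply: filterS => n.
by rewrite rnormE ltcR.
Qed.

(** [y] is a cluster point of the images [T (u n)] in the compact closure of the image of the unit
    ball. *)
Lemma compact_op_cluster (T : bounded_op V) (u : nat -> V) :
  compact_op T -> (forall n, rnorm (u n) <= 1) ->
  exists y, forall e N, 0 < e ->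
    exists2 n, (N <= n)%N & rnorm (y - T (u n)) < e.
Proof.
rewrite /compact_op precompactE => cT u1.
have [y [_ cy]] : closure (T @` [set x | rnorm x <= 1]) `&`
    cluster ((T \o u) @ \oo) !=set0.
  apply: cT; exists 0%N => // n _; apply: subset_closure.
  by exists (u n) => //=; exact: u1.
exists y => e N e0.
have eC : 0 < e%:C by rewrite ltcR.
have [_ [[n nN <-]]] :
    [set T (u n) | n in [set n | (N <= n)%N]] `&` ball y e%:C !=set0.
  apply: cy; last exact: nbhsx_ballx.
  by exists N => // n /= nN; exists n.
by rewrite -ball_normE /= rnormE ltcR => h; exists n.
Qed.

End rnorm_lemmas.

(** * Operators and unit vectors in sequence spaces *)

Section operators_on_sequence_spaces.
Context {R : realType}.
Implicit Types (E : seqspace R) (x y : nat -> R[i]).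

(** Builds both the Cesàro operator and its resolvents from maps defined on all sequences. *)
Lemma seqspace_op E (f : (nat -> R[i]) -> nat -> R[i]) (M : R) :
  (forall (a : R[i]) x y, f (a *: x + y) = a *: f x + f y) ->
  (forall x, seqspace_dom E x ->
    seqspace_dom E (f x) /\ seqspace_norm E (f x) <= M * seqspace_norm E x) ->
  exists T : bounded_op E, forall x : E, val (T x) = f (val x).
Proof.
move=> flin fE.
have fP (x : E) : f (val x) \in seqspace_pred E.
  by apply/asboolP; exact: (fE _ (seqspace_valP x)).1.
pose g (x : E) : E := exist _ (f (val x)) (fP x).
have glin : linear g by move=> a x y; apply: val_inj => /=; rewrite -flin.
pose L : {linear E -> E} := HB.pack g (GRing.isLinear.Build _ _ _ _ g glin).
have Lb : exists M : R, forall u, rnorm (L u) <= M * rnorm u.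
  by exists M => u; rewrite !rnorm_seqspace; exact: (fE _ (seqspace_valP u)).2.
by exists (BoundedOp Lb).
Qed.

Definition delta (k : nat) : nat -> R[i] := fun n => (n == k)%:R.

Lemma cesaro_linear (a : R[i]) x y :
  Defs.cesaro (a *: x + y) = a *: Defs.cesaro x + Defs.cesaro y.
Proof.
apply/funext => n; rewrite /Defs.cesaro !fctE big_split/= -scaler_sumr mulrDl.
by congr (_ + _); rewrite -mulrA.
Qed.

Lemma rnorm_cesaro_le x n : rnorm (Defs.cesaro x n) <= abs_mean x n.
Proof.
rewrite /Defs.cesaro rnormM rnormV rnorm_nat ler_wpM2r//.
exact: rnorm_sum.
Qed.

Lemma abs_mean_cesaro_le x n :
  abs_mean (Defs.cesaro x) n <= mean (abs_mean x) n.
Proof.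
apply: (@le_mean _ (fun k => rnorm (Defs.cesaro x k))) => k _.
exact: rnorm_cesaro_le.
Qed.

Lemma rnorm_le_abs_mean x n : rnorm (x n) <= n.+1%:R * abs_mean x n.
Proof.
rewrite mulrC divfK// big_ord_recr/= lerDr sumr_ge0// => k _.
exact: rnorm_ge0.
Qed.

Lemma abs_mean_delta k n : abs_mean (delta k) n = (k <= n)%:R / n.+1%:R.
Proof.
rewrite /abs_mean; congr (_ / _).
transitivity (\sum_(i < n.+1) ((i : nat) == k)%:R : R).
  by apply: eq_bigr => i _; rewrite rnorm_nat.
have [kn|nk] := leqP k n.
  rewrite (bigD1 (Ordinal (kn : (k < n.+1)%N)))//= eqxx big1 ?addr0// => i.
  by rewrite -val_eqE/= => /negbTE ->.
rewrite big1// => i _; case: eqP => // ik; have := ltn_ord i; lia.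
Qed.

Lemma cesaro_delta k n : Defs.cesaro (delta k) n = (k <= n)%:R / n.+1%:R.
Proof.
rewrite /Defs.cesaro; congr (_ / _).
have [kn|nk] := leqP k n.
  rewrite (bigD1 (Ordinal (kn : (k < n.+1)%N)))//= /delta eqxx big1 ?addr0// => i.
  by rewrite -val_eqE/= => /negbTE ->.
rewrite big1// => i _; rewrite /delta; case: eqP => // ik; have := ltn_ord i; lia.
Qed.

(** For [k <= n], the entries of the Cesàro image at the [n + 2] indices from [n] to [2 n + 1] are
    at least [1 / (2 (n + 1))], and their sum is divided by [2 (n + 1)]. *)
Lemma abs_mean_cesaro_delta k n :
  4^-1 * abs_mean (delta k) n <= abs_mean (Defs.cesaro (delta k)) n.*2.+1.
Proof.
rewrite abs_mean_delta; case: leqP => [kn|_]; last first.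
  by rewrite mul0r mulr0 abs_mean_ge0.
have n0 : 0 < n.+1%:R :> R by [].
have h i : (n <= i < n.*2.+2)%N ->
    (2 * n.+1%:R)^-1 <= rnorm (Defs.cesaro (delta k) i).
  move=> /andP[ni i2]; rewrite cesaro_delta (leq_trans kn ni) mul1r rnormV rnorm_nat.
  by rewrite lef_pV2 ?posrE// -natrM ler_nat; lia.
have := ler_sum_nat h; rewrite big_const_nat iter_addr addr0.
rewrite (_ : n.*2.+2 - n = n.+1 + 1)%N; last by lia.
rewrite -[X in X <= _]mulr_natl natrD => S1.
rewrite /abs_mean -(big_mkord xpredT (fun i => rnorm (Defs.cesaro (delta k) i))).
rewrite (@big_cat_nat _ _ _ n)//=; last by lia.
rewrite (_ : n.*2.+2%:R = 2 * n.+1%:R); last by rewrite -natrM; congr (_%:R); lia.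
rewrite mul1r ler_pdivlMr//.
apply: ler_wpDl; first by apply: sumr_ge0 => i _; exact: rnorm_ge0.
apply: le_trans S1.
have : 0 < (2 * n.+1%:R)^-1 :> R by rewrite invr_gt0 mulr_gt0.
rewrite [leRHS]mulrDl => X0; apply: ler_wpDr; first by rewrite mul1r ltW.
by rewrite le_eqVlt; apply/orP; left; apply/eqP; field; rewrite ?gt_eqF.
Qed.

End operators_on_sequence_spaces.

Lemma mean_cst (R : realType) (c : R) n : mean (fun=> c) n = c.
Proof. by rewrite /mean sumr_const card_ord -[c *+ _]mulr_natl mulrAC divff// mul1r. Qed.

Section seqspace_coordinates.
Context {R : realType} (E : seqspace R).
Implicit Types u v : E.

Lemma seqspace_valZ (a : R[i]) u k : val (a *: u) k = a * val u k.
Proof. by []. Qed.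

Lemma seqspace_valB u v k : val (u - v) k = val u k - val v k.
Proof. by []. Qed.

Lemma seqspace_val_sum I (r : seq I) (P : pred I) (F : I -> E) k :
  val (\sum_(i <- r | P i) F i) k = \sum_(i <- r | P i) val (F i) k.
Proof. by elim/big_rec2: _ => [//|i y1 y2 _ <-]. Qed.

End seqspace_coordinates.

(** * Cesaro spaces *)

(* Properties shared by the three spaces; [rho] is the norm of the Cesàro
   operator. Solidity is required along increasing reindexings [f], which is
   what the dilation [n |-> 2n+1] of the noncompactness argument needs. *)
Record cesaro_space (R : realType) (E : seqspace R) (rho : R) : Prop :=
  CesaroSpace {
    cs_rho_ge1 : 1 <= rho;
    cs_solid : forall (x y : nat -> R[i]) (f : nat -> nat),
      {homo f : m n / (m < n)%N} -> seqspace_dom E y ->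
      (forall n, abs_mean x n <= abs_mean y (f n)) ->
      seqspace_dom E x /\ seqspace_norm E x <= seqspace_norm E y;
    cs_delta : forall k, seqspace_dom E (delta k);
    cs_abs_mean_le : forall x n, seqspace_dom E x ->
      abs_mean x n <= seqspace_norm E x;
    cs_cesaro : forall x, seqspace_dom E x ->
      seqspace_dom E (Defs.cesaro x) /\
      seqspace_norm E (Defs.cesaro x) <= rho * seqspace_norm E x }.

Section cesaro_space_theory.
Context {R : realType} {E : seqspace R} {rho : R}.
Hypothesis HE : cesaro_space E rho.
Implicit Types (u v : E) (x y : nat -> R[i]).

Lemma seqspace_elt x : seqspace_dom E x -> exists u, val u = x.
Proof. by move=> xE; exists (exist _ x (asboolT xE)). Qed.

Lemma cs_le x y : seqspace_dom E y ->
  (forall n, abs_mean x n <= abs_mean y n) ->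
  seqspace_dom E x /\ seqspace_norm E x <= seqspace_norm E y.
Proof. by move=> yE xy; exact: (cs_solid HE (f := id)). Qed.

(** Continuity of the coordinate functionals, through which norm limits are identified below. *)
Lemma cs_coord u k : rnorm (val u k) <= k.+1%:R * rnorm u.
Proof.
apply: le_trans (rnorm_le_abs_mean _ _) _; rewrite ler_wpM2l//.
exact: cs_abs_mean_le HE _ _ (seqspace_valP u).
Qed.

Lemma cs_coordB u v k : rnorm (val u k - val v k) <= k.+1%:R * rnorm (u - v).
Proof. by rewrite -seqspace_valB; exact: cs_coord. Qed.

Lemma cs_op : exists T : bounded_op E, is_cesaro_op T.
Proof. exact: seqspace_op cesaro_linear (cs_cesaro HE). Qed.

Variables (T : bounded_op E) (HT : is_cesaro_op T).

Lemma rnorm_cesaro_op u : rnorm (T u) <= rho * rnorm u.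
Proof.
rewrite !rnorm_seqspace HT; exact: (cs_cesaro HE (seqspace_valP u)).2.
Qed.

(** Along the orbit [x_0] is constant and [x_0 - x_1] is halved at each step, so every [l * T^n u]
    satisfies [|x_0 - x_1| <= c |x_0|], which keeps it away from [e1]. If [u] has zeroth coordinate
    0, the scaled orbit stays away from [e0] instead. *)
Lemma cesaro_op_not_supercyclic : ~ supercyclic T.
Proof.
move=> [u uD]; have [e0 e0E] := seqspace_elt (cs_delta HE 0).
have [e1 e1E] := seqspace_elt (cs_delta HE 1).
have it0 n : val (iter n T u) 0 = val u 0.
  by elim: n => [//|n IH]; rewrite iterS HT /Defs.cesaro big_ord1 divr1.
have it1 n : val (iter n T u) 0 - val (iter n T u) 1 =
    (val u 0 - val u 1) * 2^-1 ^+ n.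
  elim: n => [|n IH]; first by rewrite expr0 mulr1.
  rewrite exprSr mulrA -IH iterS HT /Defs.cesaro big_ord1 divr1.
  by rewrite !big_ord_recl big_ord0 addr0 /=; field.
pose c := rnorm (val u 0 - val u 1) / rnorm (val u 0).
have [u0|u0] := eqVneq (val u 0) 0.
  have [s [l [n ->]]] := dense_rnorm e0 uD (ltr01 : 0 < 1 :> R).
  have := cs_coordB e0 (l *: iter n T u) 0.
  rewrite seqspace_valZ it0 u0 mulr0 e0E subr0 rnorm1 mul1r => h1 h2.
  by have := le_lt_trans h1 h2; rewrite ltxx.
have c0 : 0 <= c by rewrite divr_ge0 ?rnorm_ge0.
(* If [d] is the distance from [e1] to the scaled orbit point, its coordinates satisfy [|l a| <= d]
   and [|1 - l b| <= 2 d], whence [1 <= (c + 3) d]. *)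
have d0 : 0 < (c + 4)^-1 by rewrite invr_gt0; lra.
have [s [l [n ->]] sd] := dense_rnorm e1 uD d0.
have := cs_coordB e1 (l *: iter n T u) 0.
have := cs_coordB e1 (l *: iter n T u) 1.
rewrite e1E !seqspace_valZ.
have := it1 n; set a := val _ 0; set b := val _ 1 => ab.
have : rnorm (l * a - l * b) <= c * rnorm (l * a).
  rewrite -mulrBr !rnormM mulrCA ler_wpM2l ?rnorm_ge0// ab /a it0 /c.
  rewrite divfK ?rnorm_eq0// rnormM ler_piMr ?rnorm_ge0//.
  by rewrite rnormX rnormV rnorm_nat exprn_ile1// invr_le1// ?unitfE//; lra.
rewrite /delta/= sub0r rnormN mul1r => h1 h2 h3.
have h4 : rnorm (1 : R[i]) <= rnorm (1 - l * b) + (rnorm (l * a - l * b) + rnorm (l * a)).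
  apply: le_trans (rnorm_le_dist _ (l * b)) _; rewrite lerD2l.
  by rewrite [leRHS]addrC rdistC addrC; exact: rnorm_le_dist.
have : (c + 4) * rnorm (e1 - l *: iter n T u) < 1.
  by rewrite mulrC -ltr_pdivlMr ?div1r//; lra.
rewrite rnorm1 in h4; move: (rnorm_ge0 (e1 - l *: iter n T u)) h2 h3.
move: (rnorm (e1 - _)) => d d1 h2 h3 h5.
have : c * rnorm (l * a) <= c * d by rewrite ler_wpM2l.
lra.
Qed.

(** For the normalized unit vectors [u k], [T (u k)] vanishes at the coordinates below [k], so a
    cluster point of the images must be 0. Yet their norms are at least [1/4], by solidity along
    [m |-> 2 m + 1]. *)
Lemma cesaro_op_not_compact : ~ compact_op T.
Proof.
move=> cT; have /choice[e eE] k := seqspace_elt (cs_delta HE k).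
have e0 k : 0 < rnorm (e k).
  rewrite lt_neqAle rnorm_ge0 andbT eq_sym; apply/eqP => /rnorm0_eq0 ek.
  have : val (e k) k = 1 by rewrite eE /delta eqxx.
  by rewrite ek => /eqP; rewrite eq_sym oner_eq0.
have Te k : rnorm (e k) <= 4 * rnorm (T (e k)).
  rewrite -(rnorm_nat 4) -rnormZ !rnorm_seqspace.
  refine (cs_solid HE (f := fun m => m.*2.+1) _ (seqspace_valP _) _).2.
    by move=> m n mn; lia.
  move=> n; rewrite eE linearZ/= HT eE.
  rewrite abs_meanZ rnorm_nat mulrC -ler_pdivrMr// mulrC.
  exact: abs_mean_cesaro_delta.
pose u k := ((rnorm (e k))^-1)%:C *: e k.
have u1 k : rnorm (u k) = 1.
  by rewrite rnormZ rnormC gtr0_norm ?invr_gt0// mulVf// gt_eqF.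
have [k|y yP] := compact_op_cluster (u := u) cT; first by rewrite u1.
have Tu k : T (u k) = ((rnorm (e k))^-1)%:C *: T (e k) by rewrite linearZ.
have y0 : y = 0.
  apply: val_inj; apply/funext => k; apply: (@rnorm_eps_eq0 _ _ k.+1%:R) => d d0.
  have [n kn yd] := yP d k.+1 d0.
  have := cs_coordB y (T (u n)) k.
  rewrite Tu seqspace_valZ HT eE cesaro_delta.
  rewrite leqNgt kn mul0r mulr0 subr0 -Tu => /le_trans; apply.
  by rewrite ler_wpM2l// ltW.
have [|n _] := yP 4^-1 0; first lra.
rewrite y0 sub0r rnormN Tu rnormZ rnormC gtr0_norm ?invr_gt0// mulrC ltr_pdivrMr//.
by have := Te n; lra.
Qed.

(** The equation at [n] gives the partial sum [n + 1]; the equation at [n + 1] then leaves only the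
    value 1 for the next entry. *)
Lemma cesaro_fixed_const x : Defs.cesaro x = x -> x 0 = 1 -> x = fun=> 1.
Proof.
move=> xE x0; apply/funext; elim=> [//|n IH].
have := congr1 (@^~ n) xE; have := congr1 (@^~ n.+1) xE.
rewrite /Defs.cesaro big_ord_recr/= => h1 h2.
have s2 : \sum_(k < n.+1) x k = n.+1%:R by rewrite -[LHS](divfK (_ : n.+1%:R != 0)) ?h2 ?IH ?mul1r.
have : n.+1%:R + x n.+1 = x n.+1 * n.+2%:R by rewrite -{2}h1 s2 divfK.
rewrite -[n.+2%:R]natr1 mulrDr mulr1 => /addIr/eqP.
rewrite -{1}[n.+1%:R]mul1r => /eqP/mulIf <- //.
Qed.

(* The means [T_[n] e_0] are almost fixed by [T], coordinatewise, and have
   coordinate 1 at 0. *)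
Lemma mean_ergodic_limit (e : E) : val e = delta 0 -> mean_ergodic T ->
  exists2 y : E, val y = (fun=> 1) &
    forall d, 0 < d -> exists n, rnorm (y - ergodic_mean T n e) < d.
Proof.
move=> eE [P /(_ e) Pcvg]; exists (P e); last first.
  move=> d d0; have [n _ nP] := cvg_rnorm Pcvg d0.
  by exists n; apply: nP => /=.
have itE n : val (iter n T e) = iter n Defs.cesaro (delta 0).
  by elim: n => [//|n IH]; rewrite !iterS HT IH.
have it1 n k : rnorm (val (iter n T e) k) <= 1.
  elim: n k => [|n IH] k.
    by rewrite eE rnorm_nat; case: eqP.
  rewrite iterS HT; apply: le_trans (rnorm_cesaro_le _ _) _.
  rewrite -[leRHS](mean_cst 1 k).
  exact: (@le_mean _ (fun i => rnorm (val (iter n T e) i)) (fun=> 1)).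
have it0 n : val (iter n T e) 0 = 1.
  elim: n => [|n IH]; first by rewrite eE.
  by rewrite iterS HT /Defs.cesaro big_ord1 divr1.
have a0 n : (0 < n)%N -> val (ergodic_mean T n e) 0 = 1.
  move=> n0; rewrite seqspace_valZ seqspace_val_sum.
  under eq_bigr do rewrite it0.
  rewrite big_const_nat iter_addr addr0 subn1 mulVf//.
  by rewrite pnatr_eq0 -lt0n.
(* The difference telescopes to [(T^(n+1) e - T e) / n], and the coordinates of all iterates of [e]
   are at most 1 in modulus. *)
have aT n k : (0 < n)%N ->
    rnorm (val (T (ergodic_mean T n e) - ergodic_mean T n e) k) <= 2 / n%:R.
  move=> n0; rewrite /ergodic_mean linearZ linear_sum -scalerBr -sumrB.
  rewrite (telescope_sumr (fun m => iter m T e))//.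
  rewrite seqspace_valZ rnormM rnormV rnorm_nat mulrC ler_wpM2r//.
  rewrite seqspace_valB; apply: le_trans (rnormD _ _) _.
  by rewrite rnormN (le_trans (lerD (it1 _ _) (it1 _ _))).
apply: cesaro_fixed_const.
  rewrite -HT; apply/funext => k; apply/eqP; rewrite -subr_eq0; apply/eqP.
  (* With [a = T_[n] e], the three summands of the constant bound coordinate [k] of [T (P e - a)],
     [T a - a] and [a - P e]; [n] is taken beyond [1 / d] so that [2 / n <= 2 d]. *)
  apply: (@rnorm_eps_eq0 _ _ (k.+1%:R * rho + 2 + k.+1%:R)) => d d0.
  have [N _ NP] := cvg_rnorm Pcvg d0.
  have nd := archi_boundP (ltW (_ : 0 < d^-1)).
  pose n := (maxn N (Num.bound d^-1)).+1.
  have {NP} := NP n (leqW (leq_maxl _ _)).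
  have nN : 2 / n%:R <= 2 * d.
    rewrite ler_wpM2l// invf_ple ?posrE//.
    apply: le_trans (ltW (nd _)) _; first by rewrite invr_gt0.
    by rewrite ler_nat leqW// leq_maxr.
  move: (aT n k isT); set a := ergodic_mean T n e => Ta ya.
  rewrite -seqspace_valB.
  have -> : T (P e) - P e = T (P e - a) + (T a - a) + (a - P e).
    by rewrite (linearB T) !subrKA.
  rewrite -[val _ k]/(val (T (P e - a)) k + val (T a - a) k + val (a - P e) k).
  apply: le_trans (rnormD _ _) _.
  rewrite [leRHS]mulrDl [X in _ <= X + _]mulrDl; apply: lerD; last first.
    by apply: le_trans (cs_coord _ _) _; rewrite rdistC ler_wpM2l// ltW.
  apply: le_trans (rnormD _ _) _; apply: lerD; last exact: le_trans Ta nN.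
  apply: le_trans (cs_coord _ _) _; rewrite -mulrA ler_wpM2l//.
  apply: le_trans (rnorm_cesaro_op _) _.
  by rewrite ler_wpM2l ?ltW// (lt_le_trans ltr01)// (cs_rho_ge1 HE).
apply/eqP; rewrite -subr_eq0; apply/eqP; apply: (@rnorm_eps_eq0 _ _ 1) => d d0.
have [N _ NP] := cvg_rnorm Pcvg d0.
rewrite -(a0 N.+1)//; apply: le_trans (cs_coordB _ _ _) _; rewrite ler_wpM2l//.
exact/ltW/NP/leqW.
Qed.

End cesaro_space_theory.

(** * Eigenfunctionals and the closed disc *)

Section spectral_disc.
Context {R : realType}.
Implicit Types (z w : R[i]) (c : R).

Lemma sqr_rnorm z : rnorm z ^+ 2 = complex.Re z ^+ 2 + complex.Im z ^+ 2.
Proof. by rewrite /rnorm normc_def/= sqr_sqrtr// addr_ge0// sqr_ge0. Qed.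

(** Squared, the condition reads [|z|^2 <= 2 c Re z]. For [c > 0] and [z != 0] this says
    [Re (1/z) >= 1 / (2 c)]: inversion turns the disc into a half-plane. *)
Lemma in_disc z c : 0 <= c ->
  (`|z - c%:C| <= c%:C) =
  (complex.Re z ^+ 2 + complex.Im z ^+ 2 <= c *+ 2 * complex.Re z).
Proof.
move=> c0; rewrite rnormE lecR -ler_sqr ?nnegrE ?rnorm_ge0// sqr_rnorm.
case: z => a b /=; rewrite subr0 -subr_ge0 -[RHS]subr_ge0; congr (0 <= _).
ring.
Qed.

Lemma Re_inv z : complex.Re z^-1 =
  complex.Re z / (complex.Re z ^+ 2 + complex.Im z ^+ 2).
Proof. by case: z. Qed.

Lemma outside_disc z c : 0 < c -> ~~ (`|z - (c / 2)%:C| <= (c / 2)%:C) ->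
  z != 0 /\ complex.Re z^-1 < c^-1.
Proof.
move=> c0; rewrite in_disc; last by rewrite divr_ge0// ltW.
rewrite -[c / 2 *+ 2]mulr_natr divfK// -ltNge => h; split.
  by apply: contraTneq h => ->; rewrite /= expr0n/= addr0 mulr0 ltxx.
rewrite Re_inv; move: h; set a := complex.Re z; set n := _ + _ => h.
have n0 : 0 <= n by rewrite addr_ge0 ?sqr_ge0.
have [n00|n1] := eqVneq n 0.
  by rewrite n00 invr0 mulr0 invr_gt0.
have np : 0 < n by rewrite lt_neqAle eq_sym n1.
by rewrite ltr_pdivrMr// mulrC ltr_pdivlMr// mulrC.
Qed.

(* [w^-1] is a point of the open disc at distance less than [1/M] from [z]. *)
Lemma closed_disc_approx z c (M : R) : 0 < c -> 0 <= M ->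
  `|z - (c / 2)%:C| <= (c / 2)%:C ->
  exists2 w, c^-1 < complex.Re w & rnorm (z * w - 1) * M < rnorm w.
Proof.
move=> c0 M0 zd; set r := c / 2 in zd.
have r0 : 0 < r by rewrite divr_gt0.
(* [z'] is [z] moved by the fraction [t] towards the centre [r], so that [|z' - z| <= t r] with
   [t r M < 1]. For [w = 1 / z'] one has [z w - 1 = (z - z') w]. *)
pose t := (r * M + 2)^-1.
have rM : 0 <= r * M by rewrite mulr_ge0// ltW.
have t0 : 0 < t by rewrite invr_gt0; lra.
have t1 : t < 1 by rewrite invf_lt1; lra.
have tM : t * (r * M) < 1.
  by rewrite mulrC ltr_pdivrMr; lra.
pose z' := z + t%:C * (r%:C - z).
have zr : rnorm (z - r%:C) <= r by move: zd; rewrite rnormE lecR.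
have z'r : rnorm (z' - r%:C) < r.
  have -> : z' - r%:C = (1 - t)%:C * (z - r%:C).
    by rewrite /z' rmorphB/= rmorph1; ring.
  rewrite rnormM rnormC gtr0_norm; last lra.
  apply: (@le_lt_trans _ _ ((1 - t) * r)); first by rewrite ler_wpM2l//; lra.
  by rewrite gtr_pMl//; lra.
have : complex.Re z' ^+ 2 + complex.Im z' ^+ 2 < c * complex.Re z'.
  move: z'r; rewrite -ltr_sqr ?nnegrE ?rnorm_ge0//; last exact: ltW.
  rewrite sqr_rnorm; case: (z') => a b /=; rewrite subr0 -subr_gt0 => h.
  rewrite -subr_gt0 (_ : _ - _ = r ^+ 2 - ((a - r) ^+ 2 + b ^+ 2))//.
  have -> : c = r * 2 by rewrite divfK.
  by move: (r) => ?; ring.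
have zz' : rnorm (z' - z) <= t * r.
  rewrite /z' addrAC subrr add0r rnormM rnormC gtr0_norm// ler_wpM2l ?(ltW t0)//.
  by rewrite rdistC.
move=> h; have z'0 : z' != 0.
  by apply: contraTneq h => ->; rewrite /= expr0n/= addr0 mulr0 ltxx.
exists z'^-1.
  have n0 : 0 < rnorm z' ^+ 2 by rewrite exprn_gt0// rnorm_gt0.
  rewrite Re_inv -sqr_rnorm; rewrite -sqr_rnorm in h.
  by rewrite ltr_pdivlMr// mulrC ltr_pdivrMr// mulrC.
have -> : z * z'^-1 - 1 = (z - z') * z'^-1 by field.
rewrite rnormM mulrAC gtr_pMl; last by rewrite rnorm_gt0 invr_eq0.
apply: le_lt_trans tM; rewrite mulrA ler_wpM2r//.
by rewrite rdistC.
Qed.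

End spectral_disc.

Section eigenfunctionals.
Context {R : realType}.
Implicit Types (x : nat -> R[i]) (w : R[i]) (s : R).

(* [eigvec w] is the eigenvector of the transposed Cesàro matrix for the
   eigenvalue [w^-1]. *)
Definition eigvec w (k : nat) : R[i] := \prod_(j < k) (1 - w / j.+1%:R).

(** Partial sums of the pairing with [eigvec w]; they stand for the eigenfunctional, whose infinite
    sum is never formed. *)
Definition eigsum w N x : R[i] := \sum_(k < N) x k * eigvec w k.

(** The eigenvalue equation for the truncated pairing; the right-hand side is the boundary term,
    which the decay of [eigvec] sends to 0. *)
Lemma eigsum_cesaro w N x :
  w * eigsum w N (Defs.cesaro x) - eigsum w N x =
  - (eigvec w N * \sum_(k < N) x k).
Proof.
elim: N => [|N IH]; first by rewrite /eigsum !big_ord0 !mulr0 subr0 oppr0.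
move: IH; rewrite /eigsum !big_ord_recr/= /eigvec big_ord_recr/= -/(eigvec w N).
rewrite /Defs.cesaro big_ord_recr/=.
set S := \sum_(i < N) x i; set A := \sum_(i < N) _; set B := \sum_(i < N) _.
move=> /eqP; rewrite subr_eq => /eqP h; rewrite mulrDr h.
have : N.+1%:R != 0 :> R[i] by [].
by move=> ?; field.
Qed.

(** For [m = j + 1 >= |w|^2 / (Re w - s)], [|1 - w/m|^2 <= 1 - 2 s/m <= exp (- 2 s/m)], and
    [exp (- s/m) <= (m / (m + 1))^s]. The last bounds telescope in a product. *)
Lemma rnorm_factor_le w s : 0 < s < complex.Re w ->
  exists J, forall j, (J <= j)%N ->
    rnorm (1 - w / j.+1%:R) <= (j.+1%:R / j.+2%:R) `^ s.
Proof.
move=> /andP[s0 sw]; pose J := Num.bound (rnorm w ^+ 2 / (complex.Re w - s)).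
exists J => j Jj; have j0 : 0 < j.+1%:R :> R by [].
have wj : rnorm w ^+ 2 <= (complex.Re w - s) * j.+1%:R.
  rewrite mulrC -ler_pdivrMr; last lra.
  have : rnorm w ^+ 2 / (complex.Re w - s) < J%:R.
    by apply: archi_boundP; rewrite divr_ge0 ?sqr_ge0//; lra.
  move=> /ltW/le_trans; apply.
  by rewrite ler_nat leqW.
apply: (@le_trans _ _ (expR (- (s / j.+1%:R)))); last first.
  have jj : 0 < j.+1%:R / j.+2%:R :> R by rewrite divr_gt0.
  rewrite /powR gt_eqF// ler_expR -mulrN ler_wpM2l ?(ltW s0)//.
  rewrite lerNl -lnV ?posrE// invf_div.
  have -> : j.+2%:R / j.+1%:R = 1 + j.+1%:R^-1 :> R.
    by rewrite -[j.+2%:R]natr1 mulrDl divff// mul1r.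
  by rewrite le_ln1Dx// (lt_trans (ltrN10 _))// invr_gt0.
rewrite -ler_sqr ?nnegrE ?rnorm_ge0 ?expR_ge0// -expRM_natl.
apply: le_trans (expR_ge1Dx _).
have -> : j.+1%:R = (j.+1%:R : R)%:C :> R[i] by rewrite natrC.
rewrite sqr_rnorm; move: wj; rewrite sqr_rnorm.
have -> : (j.+1%:R : R)%:C^-1 = (j.+1%:R^-1)%:C :> R[i] by rewrite fmorphV.
clear Jj J; move: sw; case: w => a b /= sw.
rewrite !mulr0 !(subr0, sub0r, addr0, add0r) sqrrN.
have jV : j.+1%:R * j.+1%:R^-1 = 1 :> R by rewrite divff.
have i0 : 0 < j.+1%:R^-1 :> R by rewrite invr_gt0.
move: (j.+1%:R : R) (j.+1%:R^-1 : R) jV i0 j0 => m i mi i0 m0 h.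
have : i ^+ 2 * (a ^+ 2 + b ^+ 2) <= i ^+ 2 * ((a - s) * m).
  by rewrite ler_wpM2l ?sqr_ge0.
have -> : i ^+ 2 * ((a - s) * m) = (a - s) * i * (m * i) by ring.
rewrite mi mulr1 => h1.
have -> : (1 - a * i) ^+ 2 + (b * i) ^+ 2 =
  1 - 2 * a * i + i ^+ 2 * (a ^+ 2 + b ^+ 2) by ring.
have : 0 <= (a - s) * i by rewrite mulr_ge0; lra.
lra.
Qed.

(** By [rnorm_factor_le], [F] does not increase from [J] on, so the sum of its first [J + 1] values
    bounds it. *)
Lemma eigvec_decay w s : 0 < s < complex.Re w ->
  exists2 K, 0 <= K & forall k, rnorm (eigvec w k) <= K * k.+1%:R `^ (- s).
Proof.
move=> sw; have [J HJ] := rnorm_factor_le sw.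
pose F k := rnorm (eigvec w k) * k.+1%:R `^ s.
have pw0 k : 0 < k.+1%:R `^ s by rewrite powR_gt0.
have F0 k : 0 <= F k by rewrite mulr_ge0 ?rnorm_ge0// ltW.
suff [K K0 KF] : exists2 K, 0 <= K & forall k, F k <= K.
  by exists K => // k; rewrite powRN ler_pdivlMr ?pw0//; exact: KF.
exists (\sum_(k < J.+1) F k); first exact: sumr_ge0.
have small k : (k <= J)%N -> F k <= \sum_(k < J.+1) F k.
  move=> kJ; rewrite (bigD1 (Ordinal (kJ : (k < J.+1)%N)))//= lerDl.
  exact: sumr_ge0.
elim=> [|k IH]; first exact: small.
have [kJ|Jk] := leqP k.+1 J; first exact: small.
apply: le_trans IH; rewrite /F /eigvec big_ord_recr/= -/(eigvec w k).
rewrite rnormM -mulrA ler_wpM2l ?rnorm_ge0// -ler_pdivlMr//.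
apply: le_trans (HJ k Jk) _.
by rewrite powRM ?invr_ge0// -powR_inv1// -powRrM mulN1r powRN.
Qed.

End eigenfunctionals.

Section spectrum_disc.
Context {R : realType} {E : seqspace R} {rho : R}.
Hypothesis HE : cesaro_space E rho.
(** Power weights with exponent beyond [1/rho] define bounded functionals; [ces_dual] and
    [ces_0_dual] verify this. *)
Hypothesis Hdual : forall s, rho^-1 < s ->
  exists2 K, 0 <= K & forall N x, seqspace_dom E x ->
    \sum_(k < N) rnorm (x k) * k.+1%:R `^ (- s) <= K * seqspace_norm E x.
Implicit Types (u v : E) (w z : R[i]).

Let rho0 : 0 < rho. Proof. exact: lt_le_trans ltr01 (cs_rho_ge1 HE). Qed.

Lemma cvg_powRN (d : R) : 0 < d -> (fun N => N.+1%:R `^ (- d)) @ \oo --> (0 : R).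
Proof.
move=> d0; apply/cvgrPdist_le => e e0; exists (Num.bound (e^-1 `^ d^-1)) => // N /= NB.
rewrite sub0r normrN ger0_norm ?powR_ge0// powRN invf_ple ?posrE ?powR_gt0//.
have -> : e^-1 = (e^-1 `^ d^-1) `^ d.
  by rewrite -powRrM mulVf ?gt_eqF// powRr1// invr_ge0 ltW.
apply: ge0_ler_powR; rewrite ?nnegrE ?powR_ge0 ?(ltW d0)//.
apply: le_trans (ltW (archi_boundP (powR_ge0 _ _))) _.
by rewrite ler_nat leqW.
Qed.

Lemma eigsum_bounded w : rho^-1 < complex.Re w ->
  exists K, (forall N u, rnorm (eigsum w N (val u)) <= K * rnorm u) /\
   (forall u, (fun N => rnorm (w * eigsum w N (Defs.cesaro (val u)) -
      eigsum w N (val u))) @ \oo --> (0 : R)).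
Proof.
move=> rw; have rV0 : 0 < rho^-1 by rewrite invr_gt0.
(* Here [rho^-1 < s < s' < Re w]. [Hdual] is applied at [s] and the decay of [eigvec] at [s']; the
   gap [s' - s] makes the boundary term of [eigsum_cesaro] tend to 0. *)
pose s := (rho^-1 + complex.Re w) / 2; pose s' := (s + complex.Re w) / 2.
have rs : rho^-1 < s by rewrite /s; lra.
have ss' : s < s' by rewrite /s' /s; lra.
have s'w : 0 < s' < complex.Re w by apply/andP; split; rewrite /s' /s; lra.
have [K K0 HK] := eigvec_decay s'w; have [D D0 HD] := Hdual rs.
have dec n k : (k <= n)%N -> n.+1%:R `^ (- s') <=
    n.+1%:R `^ (- (s' - s)) * k.+1%:R `^ (- s).
  move=> kn; rewrite -[- s']/(- s') (_ : - s' = - (s' - s) + - s); last by lra.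
  rewrite powRD ?pnatr_eq0 ?implybT// ler_wpM2l ?powR_ge0// !powRN lef_pV2 ?posrE ?powR_gt0//.
  by apply: ge0_ler_powR; rewrite ?nnegrE ?ler_nat//; lra.
exists (K * D); split=> [N u|u].
  apply: le_trans (rnorm_sum _ _ _) _; rewrite -mulrA.
  apply: le_trans (ler_wpM2l K0 (HD N _ (seqspace_valP u))).
  rewrite mulr_sumr; apply: ler_sum => k _; rewrite rnormM mulrCA.
  rewrite ler_wpM2l ?rnorm_ge0//; apply: le_trans (HK k) _; rewrite ler_wpM2l//.
  by apply: ler_powR; rewrite ?ler1n// lerN2 ltW.
have h0 : (fun N => K * D * rnorm u * N.+1%:R `^ (- (s' - s))) @ \oo --> (0 : R).
  rewrite -(mulr0 (K * D * rnorm u)); apply: cvgMl_tmp.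
  by apply: cvg_powRN; lra.
apply: (squeeze_cvgr _ (cvg_cst 0) h0); apply: nearW => N.
rewrite rnorm_ge0 eigsum_cesaro rnormN rnormM.
apply: le_trans (ler_wpM2l (rnorm_ge0 _) (rnorm_sum _ _ _)) _.
apply: le_trans (ler_wpM2r _ (HK N)) _; first by rewrite sumr_ge0// => k _; exact: rnorm_ge0.
rewrite -!mulrA ler_wpM2l// [in leRHS]mulrA [in leRHS]mulrC.
apply: le_trans (ler_wpM2l (powR_ge0 _ _) (HD N _ (seqspace_valP u))).
rewrite !mulr_sumr; apply: ler_sum => k _; rewrite mulrC mulrCA.
by rewrite ler_wpM2l ?rnorm_ge0//; apply: dec; exact: ltnW.
Qed.

(** If [phi] is the eigenfunctional, [a phi (u_(j+1)) = b phi (u_j)] and [phi (e_0) = 1] give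
    [a^j phi (u_j) = b^j], and [phi] is bounded. It serves for the iterates of [T] and for those of
    a hypothetical inverse of [z - T]. *)
Lemma eigsum_geometric w (a b : R[i]) (u : nat -> E) :
  rho^-1 < complex.Re w -> val (u 0%N) = delta 0 ->
  (forall j, (fun N => rnorm (a * eigsum w N (val (u j.+1)) -
                              b * eigsum w N (val (u j)))) @ \oo --> (0 : R)) ->
  exists K, forall j, rnorm b ^+ j <= K * (rnorm a ^+ j * rnorm (u j)).
Proof.
move=> rw u0 ab; have [K [HK _]] := eigsum_bounded rw; exists K => j.
suff h : (fun N => rnorm (a ^+ j * eigsum w N (val (u j)) - b ^+ j)) @ \oo --> (0 : R).
  apply/ler_addgt0Pr => d d0.
  have /cvgrPdist_lt/(_ d d0)[N _ /(_ N (leqnn _))] := h.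
  rewrite sub0r normrN ger0_norm ?rnorm_ge0// => hN.
  rewrite -rnormX addrC; apply: le_trans (rnorm_le_dist _ (a ^+ j * eigsum w N (val (u j)))) _.
  rewrite rdistC lerD ?(ltW hN)// rnormM rnormX mulrCA ler_wpM2l ?exprn_ge0 ?rnorm_ge0//.
elim: j => [|j IH].
  apply: cvg_near_cst; exists 1%N => // N /= N1.
  rewrite !expr0 mul1r u0 /eigsum -(prednK N1) big_ord_recl big1 => [|i _].
    by rewrite /eigvec big_ord0 mulr1 addr0 /delta eqxx subrr rnorm0.
  by rewrite /delta /= mul0r.
pose F N := rnorm a ^+ j * rnorm (a * eigsum w N (val (u j.+1)) -
    b * eigsum w N (val (u j))) +
  rnorm b * rnorm (a ^+ j * eigsum w N (val (u j)) - b ^+ j).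
have h0 : F @ \oo --> (0 : R).
  suff : F @ \oo --> rnorm a ^+ j * 0 + rnorm b * 0 by rewrite !mulr0 addr0.
  by apply: cvgD; apply: cvgMl_tmp; [exact: ab|exact: IH].
apply: (squeeze_cvgr _ (cvg_cst 0) h0); apply: nearW => N.
rewrite rnorm_ge0 /F /= -rnormX -!rnormM; apply: le_trans (rnormD _ _).
by rewrite le_eqVlt; apply/orP; left; apply/eqP; congr rnorm; rewrite !exprS; ring.
Qed.

Lemma geometric_absurd (K r t : R) : 0 <= t < r ->
  ~ (forall j, r ^+ j <= K * t ^+ j).
Proof.
move=> /andP[t0 tr] h; have r0 : 0 < r by exact: le_lt_trans tr.
have q1 : `|t / r| < 1 by rewrite ger0_norm ?divr_ge0 ?(ltW r0)// ltr_pdivrMr// mul1r.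
have /cvgrPdist_lt/(_ 1 ltr01)[N _ /(_ N (leqnn _))] := cvg_geometric K q1.
rewrite sub0r normrN /= => /(le_lt_trans (ler_norm _)).
by rewrite expr_div_n mulrA ltr_pdivrMr ?exprn_gt0// mul1r ltNge h.
Qed.

Variables (T : bounded_op E) (HT : is_cesaro_op T).

Lemma iter_cesaro_op_lower w (e : E) : rho^-1 < complex.Re w ->
  val e = delta 0 ->
  exists K, forall j, 1 <= K * (rnorm w ^+ j * rnorm (iter j T e)).
Proof.
move=> rw eE; have [_ [_ HK]] := eigsum_bounded rw.
have [||K KP] := @eigsum_geometric w w 1 (fun j => iter j T e) rw; first by [].
  by move=> j; under eq_fun do rewrite iterS HT mul1r; exact: HK.
by exists K => j; rewrite -(expr1n _ j) -rnorm1.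
Qed.

(** An inverse [S] with bound [M] would satisfy [(z w - 1)^j phi (S^j e) = w^j] for the
    eigenfunctional [phi]; this is impossible once [|z w - 1| M < |w|]. *)
Lemma disc_sub_spectrum :
  [set z | `|z - (rho / 2)%:C| <= (rho / 2)%:C] `<=` spectrum T.
Proof.
move=> z /= zd [S [_ HS]].
have [M0 HM0] := bounded_op_bounded S; pose M := Num.max M0 0.
have M_ge0 : 0 <= M by rewrite le_max lexx orbT.
have HM u : rnorm (S u) <= M * rnorm u.
  apply: le_trans (HM0 u) _; rewrite ler_wpM2r ?rnorm_ge0//.
  by rewrite le_max lexx.
have [w rw wz] := closed_disc_approx rho0 M_ge0 zd.
have [e eE] := seqspace_elt (cs_delta HE 0).
have [_ [_ HK]] := eigsum_bounded rw.
have phiE N v : eigsum w N (val (z *: v - T v)) =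
    z * eigsum w N (val v) - eigsum w N (Defs.cesaro (val v)).
  rewrite /eigsum mulr_sumr -sumrB; apply: eq_bigr => k _.
  by rewrite seqspace_valB seqspace_valZ HT mulrBl mulrA.
have [||K KP] := @eigsum_geometric w (z * w - 1) w (fun j => iter j S e) rw; first by [].
  (* For [v = S^(j+1) e] one has [S^j e = z v - T v], so the difference in question is
     [w phi (C v) - phi v]. *)
  move=> j; have := HK (iter j.+1 S e).
  apply: cvg_trans; apply: near_eq_cvg; apply: nearW => N.
  have <- : z *: iter j.+1 S e - T (iter j.+1 S e) = iter j S e by rewrite iterS HS.
  by rewrite phiE; congr rnorm; ring.
have iS j : rnorm (iter j S e) <= M ^+ j * rnorm e.
  elim: j => [|j IH]; first by rewrite expr0 mul1r.
  by rewrite iterS exprS -mulrA; apply: le_trans (HM _) _; rewrite ler_wpM2l.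
apply: (@geometric_absurd (`|K| * rnorm e) (rnorm w) (rnorm (z * w - 1) * M)).
  by rewrite mulr_ge0 ?rnorm_ge0.
move=> j; apply: le_trans (KP j) _.
apply: (@le_trans _ _ (`|K| * (rnorm (z * w - 1) ^+ j * rnorm (iter j S e)))).
  by rewrite ler_wpM2r ?ler_norm// mulr_ge0 ?exprn_ge0 ?rnorm_ge0.
rewrite -mulrA ler_wpM2l// exprMn mulrCA ler_wpM2l ?exprn_ge0 ?rnorm_ge0//.
by rewrite mulrC.
Qed.

End spectrum_disc.

(** * The resolvent outside the disc *)

Section resolvent_sequences.
Context {F : fieldType}.
Implicit Types (w : F) (x y : nat -> F).

(* With [w = z^-1], [resolvent w x] is the solution [y] of [z y - C y = x] and
   [resolvent_sum w x] is the sequence of its partial sums. *)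
Fixpoint resolvent_sum w x n : F :=
  if n is m.+1 then (resolvent_sum w x m + w * x n) / (1 - w / n.+1%:R)
  else w * x 0 / (1 - w).

Definition resolvent w x n : F := w * (x n + resolvent_sum w x n / n.+1%:R).

Hypothesis natF : forall n, n.+1%:R != 0 :> F.
Variables (w : F) (wn : forall n, 1 - w / n.+1%:R != 0).

Let w1 : 1 - w != 0. Proof. by have := wn 0; rewrite divr1. Qed.

Lemma sum_resolvent x n :
  \sum_(k < n.+1) resolvent w x k = resolvent_sum w x n.
Proof.
elim: n => [|n IH].
  by rewrite big_ord1 /resolvent /= divr1; field.
rewrite big_ord_recr/= IH /resolvent /=.
have := wn n.+1; have := natF n.+1.
move: (resolvent_sum w x n) (x n.+1) (n.+2%:R : F) => s t m m0 mw.
have mw' : m - w != 0 by apply: contraNneq mw => h; rewrite -(divff m0) -mulrBl h mul0r.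
by field; rewrite m0 mw'.
Qed.

(** As [1 - w / (n + 1)] is invertible, the equation at [n] determines the partial sum up to [n]
    from the previous one. Linearity of [resolvent] and the left inverse property both come from
    this uniqueness. *)
Lemma resolvent_unique x y :
  (forall n, y n = w * (x n + (\sum_(k < n.+1) y k) / n.+1%:R)) ->
  y = resolvent w x.
Proof.
move=> yE; suff ys n : \sum_(k < n.+1) y k = resolvent_sum w x n.
  by apply/funext => n; rewrite yE ys.
elim: n => [|n IH] /=.
  rewrite big_ord1; have := yE 0%N; rewrite big_ord1 divr1 => h.
  by apply: (mulIf w1); rewrite divfK// mulrBr mulr1 {1}h; ring.
rewrite -IH; apply: (mulIf (wn n.+1)); rewrite divfK//.
have : \sum_(k < n.+2) y k = \sum_(k < n.+1) y k + y n.+1 by rewrite big_ord_recr.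
have := yE n.+1; move: (\sum_(k < n.+2) y k) => t h tE.
by rewrite mulrBr mulr1 {1}tE h; ring.
Qed.

Lemma resolvent_linear (a : F) x y n :
  resolvent w (fun n => a * x n + y n) n =
  a * resolvent w x n + resolvent w y n.
Proof.
suff -> : resolvent w (fun n => a * x n + y n) =
    fun n => a * resolvent w x n + resolvent w y n by [].
apply/esym/resolvent_unique => {}n.
by rewrite big_split/= -mulr_sumr !sum_resolvent /resolvent; ring.
Qed.

End resolvent_sequences.

Section resolvent_bounds.
Context {R : realType}.
Implicit Types (x : nat -> R[i]) (w : R[i]) (a : R).

(** The majorizing recursion runs on these moduli in [R], the original one in [R[i]]; this is why
    [resolvent] is defined over any field. *)
Definition cabs x : nat -> R := fun n => rnorm (x n).

Lemma resolvent_factor_gt0 a n : 0 < a < 1 -> 0 < 1 - a / n.+1%:R.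
Proof.
move=> /andP[a0 a1]; rewrite subr_gt0 ltr_pdivrMr// mul1r.
by apply: lt_le_trans a1 _; rewrite ler1n.
Qed.

Lemma resolvent_sum_ge0 a x n : 0 < a < 1 -> 0 <= resolvent_sum a (cabs x) n.
Proof.
move=> a01; have /andP[a0 _] := a01.
elim: n => [|n IH] /=.
  rewrite divr_ge0 ?mulr_ge0 ?rnorm_ge0 ?(ltW a0)//.
  by have := resolvent_factor_gt0 0 a01; rewrite divr1 => /ltW.
by rewrite divr_ge0 ?(ltW (resolvent_factor_gt0 _ _))// addr_ge0// mulr_ge0 ?rnorm_ge0// ltW.
Qed.

Lemma resolvent_ge0 a x n : 0 < a < 1 -> 0 <= resolvent a (cabs x) n.
Proof.
move=> a01; have /andP[a0 _] := a01.
by rewrite mulr_ge0 ?(ltW a0)// addr_ge0 ?rnorm_ge0// divr_ge0// resolvent_sum_ge0.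
Qed.

Lemma resolvent_factor_le a w n : complex.Re w <= a ->
  1 - a / n.+1%:R <= rnorm (1 - w / n.+1%:R).
Proof.
move=> wa; apply: le_trans (Re_le_rnorm _).
have -> : n.+1%:R^-1 = (n.+1%:R^-1)%:C :> R[i] by rewrite natrC fmorphV.
case: w wa => b c /= ba; rewrite mulr0 subr0 lerD2l lerN2.
by rewrite ler_wpM2r ?invr_ge0.
Qed.

Lemma resolvent_factor_neq0 a w n : 0 < a < 1 -> complex.Re w <= a ->
  1 - w / n.+1%:R != 0.
Proof.
move=> a01 wa; rewrite -rnorm_gt0.
exact: lt_le_trans (resolvent_factor_gt0 _ a01) (resolvent_factor_le _ wa).
Qed.

(** By [resolvent_factor_le], dividing by [1 - w/m] enlarges the modulus at most as much as dividing
    by [1 - a/m]; the factor [rnorm w / a] turns the source [a |x|] into [|w x|]. *)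
Lemma rnorm_resolvent_sum_le a w x n : 0 < a < 1 -> complex.Re w <= a ->
  rnorm (resolvent_sum w x n) <= rnorm w / a * resolvent_sum a (cabs x) n.
Proof.
move=> a01 wa; have /andP[a0 _] := a01.
have step k (b c : R) (s : R[i]) : 0 <= b -> rnorm s <= rnorm w / a * b ->
    rnorm (s / (1 - w / k.+1%:R)) <= rnorm w / a * (b / (1 - a / k.+1%:R)).
  move=> b0 sb; rewrite rnormM rnormV mulrA; apply: ler_pM; rewrite ?invr_ge0 ?rnorm_ge0//.
  rewrite lef_pV2 ?posrE; first exact: resolvent_factor_le.
  - exact: lt_le_trans (resolvent_factor_gt0 _ a01) (resolvent_factor_le _ wa).
  - exact: resolvent_factor_gt0.
have wx k : rnorm (w * x k) = rnorm w / a * (a * cabs x k).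
  by rewrite rnormM mulrA divfK// gt_eqF.
elim: n => [|n IH] /=.
  have := step 0%N (a * cabs x 0) 0 (w * x 0); rewrite !divr1; apply.
    by rewrite mulr_ge0 ?rnorm_ge0// ltW.
  by rewrite wx.
apply: step => //.
  by rewrite addr_ge0 ?resolvent_sum_ge0// mulr_ge0 ?rnorm_ge0// ltW.
by apply: le_trans (rnormD _ _) _; rewrite mulrDr lerD// wx.
Qed.

Lemma rnorm_resolvent_le a w x n : 0 < a < 1 -> complex.Re w <= a ->
  rnorm (resolvent w x n) <=
  rnorm w * (1 + rnorm w / a) / a * resolvent a (cabs x) n.
Proof.
move=> a01 wa; have /andP[a0 _] := a01; rewrite /resolvent rnormM.
have q0 : 0 <= rnorm w / a by rewrite divr_ge0 ?rnorm_ge0// ltW.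
rewrite -!mulrA ler_wpM2l ?rnorm_ge0// mulKf ?gt_eqF//.
apply: le_trans (rnormD _ _) _; rewrite rnormM rnormV rnorm_nat mulrDr lerD//.
  by rewrite ler_peMl ?rnorm_ge0// lerDl.
rewrite mulrA ler_wpM2r ?invr_ge0//; apply: le_trans (rnorm_resolvent_sum_le _ _ a01 wa) _.
by rewrite ler_wpM2r ?resolvent_sum_ge0// lerDr.
Qed.

End resolvent_bounds.

Section resolvent_operator.
Context {R : realType} {E : seqspace R} {rho : R}.
Hypothesis HE : cesaro_space E rho.
Implicit Types (x y : nat -> R[i]) (w z : R[i]) (a : R).

Definition realseq (v : nat -> R) : nat -> R[i] := fun n => (v n)%:C.

Lemma cabs_realseq v n : (forall k, 0 <= v k) -> cabs (realseq v) n = v n.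
Proof. by move=> v0; rewrite /cabs rnormC ger0_norm. Qed.

Lemma abs_mean_realseq v : (forall k, 0 <= v k) ->
  abs_mean (realseq v) = mean v.
Proof.
move=> v0; apply/funext => n; rewrite /abs_mean /mean; congr (_ / _).
by apply: eq_bigr => k _; rewrite -/(cabs (realseq v) k) cabs_realseq.
Qed.

Definition trunc N x : nat -> R[i] := fun k => if (k < N)%N then x k else 0.

Lemma seqspace_dom_trunc N x : seqspace_dom E (trunc N x).
Proof.
elim: N => [|N IH].
  by rewrite (_ : trunc 0 x = 0); [exact: seqspace_dom0|exact/funext].
rewrite (_ : trunc N.+1 x = trunc N x + x N *: delta N).
  by apply: seqspace_domD => //; apply: seqspace_domZ; exact: cs_delta HE N.
apply/funext => k; rewrite fctE /trunc [X in _ + X](_ : _ = x N * delta N k)//.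
rewrite /delta ltnS leq_eqVlt; case: (ltngtP k N) => [kN|kN|->] /=.
- by rewrite mulr0 addr0.
- by rewrite mulr0 addr0.
- by rewrite mulr1 add0r.
Qed.

(** The truncation [u] of [v] is finitely supported, so its norm may be used before [v] is known to
    lie in the space. Below [N] the means of [u] and [v] agree, hence [u <= a (|x| + C u)]; solidity
    gives [|u| <= a (|x| + rho |u|)] for the norms, to be solved with [a rho < 1]. *)
Lemma seqspace_norm_trunc_resolvent a x N : 0 < a < rho^-1 ->
  seqspace_dom E x ->
  seqspace_norm E (trunc N (realseq (resolvent a (cabs x)))) <=
  a / (1 - a * rho) * seqspace_norm E x.
Proof.
move=> /andP[a0 ar] xE.
have r1 := cs_rho_ge1 HE; have r0 : 0 < rho by lra.
have ar1 : a * rho < 1 by rewrite -ltr_pdivlMr// div1r.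
have a01 : 0 < a < 1.
  by rewrite a0/=; apply: lt_le_trans ar _; rewrite invf_le1.
set v := resolvent a _; set u := trunc N _.
have v0 k : 0 <= v k by exact: resolvent_ge0.
have uE := seqspace_dom_trunc N (realseq v).
have [CuE Cule] := cs_cesaro HE uE.
pose cx := realseq (cabs x).
have cx0 k : 0 <= cabs x k by exact: rnorm_ge0.
have [cxE cxle] : seqspace_dom E cx /\ seqspace_norm E cx <= seqspace_norm E x.
  by apply: (cs_le HE) => // n; rewrite abs_mean_realseq.
have cuE : seqspace_dom E (a%:C *: (cx + Defs.cesaro u)).
  by apply: seqspace_domZ; exact: seqspace_domD.
have ur : u = realseq (fun k => if (k < N)%N then v k else 0).
  by apply/funext => k; rewrite /u /trunc /realseq; case: ifP.
have u0 k : 0 <= (if (k < N)%N then v k else 0) by case: ifP.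
have CuR : Defs.cesaro u = realseq (mean (fun k => if (k < N)%N then v k else 0)).
  apply/funext => n; rewrite /Defs.cesaro /realseq /mean rmorphM fmorphV rmorph_nat.
  by rewrite rmorph_sum ur.
have [_ ule] : seqspace_dom E u /\
    seqspace_norm E u <= seqspace_norm E (a%:C *: (cx + Defs.cesaro u)).
  apply: (cs_le HE) => // n.
  rewrite ur abs_mean_realseq// -ur.
  have -> : a%:C *: (cx + Defs.cesaro u) = realseq (fun k =>
      a * (cabs x k + mean (fun k => if (k < N)%N then v k else 0) k)).
    by apply/funext => k; rewrite CuR /realseq rmorphM rmorphD.
  have m0 k : 0 <= mean (fun k => if (k < N)%N then v k else 0) k by exact: mean_ge0.
  rewrite abs_mean_realseq; last by move=> k; rewrite mulr_ge0 ?addr_ge0// ltW.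
  apply: le_mean => k _; case: ifP => kN; last by rewrite mulr_ge0 ?addr_ge0// ltW.
  rewrite {1}/v /resolvent ler_wpM2l ?(ltW a0)// lerD2l.
  rewrite -sum_resolvent//; last first.
    by move=> n'; rewrite gt_eqF// resolvent_factor_gt0.
  rewrite le_eqVlt; apply/orP; left; apply/eqP; congr (_ / _).
  by apply: eq_bigr => j _; rewrite (leq_ltn_trans _ kN)// -ltnS.
have : seqspace_norm E u <= a * (seqspace_norm E x + rho * seqspace_norm E u).
  apply: le_trans ule _; rewrite seqspace_normZ; last exact: seqspace_domD.
  rewrite rnormC gtr0_norm// ler_wpM2l ?(ltW a0)//.
  by apply: le_trans (seqspace_normD _ _) _ => //; exact: lerD.
rewrite mulrAC ler_pdivlMr; last lra.
by move: (seqspace_norm E u) (seqspace_norm E x) => p q h; lra.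
Qed.

(** The passage from truncations to the whole sequence depends on the space; see [ces_resolvent] and
    [ces_0_resolvent]. *)
Hypothesis Hres : forall a, 0 < a < rho^-1 -> exists M, forall x,
  seqspace_dom E x ->
  seqspace_dom E (realseq (resolvent a (cabs x))) /\
  seqspace_norm E (realseq (resolvent a (cabs x))) <= M * seqspace_norm E x.
Variables (T : bounded_op E) (HT : is_cesaro_op T).

(** The inverse of [z - T] is [resolvent w]; solidity transfers to it the bound for the majorant
    [resolvent a]. *)
Lemma spectrum_sub_disc :
  spectrum T `<=` [set z | `|z - (rho / 2)%:C| <= (rho / 2)%:C].
Proof.
move=> z /= zT; apply/negPn/negP => zd; apply: zT.
have r1 := cs_rho_ge1 HE; have r0 : 0 < rho by lra.
have [z0 zr] := outside_disc r0 zd.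
have rV0 : 0 < rho^-1 by rewrite invr_gt0.
set w := z^-1 in zr; pose m := Num.max (complex.Re w) 0.
pose a := (m + rho^-1) / 2.
have mr : m < rho^-1 by rewrite gt_max zr.
have wm : complex.Re w <= m by rewrite le_max lexx.
have m0 : 0 <= m by rewrite le_max lexx orbT.
have wa : complex.Re w <= a by rewrite /a; lra.
have ar : 0 < a < rho^-1 by apply/andP; split; rewrite /a; lra.
have a01 : 0 < a < 1.
  by case/andP: ar => -> /lt_le_trans; apply; rewrite invf_le1.
have wn n : 1 - w / n.+1%:R != 0 by exact: resolvent_factor_neq0 a01 wa.
have nC n : n.+1%:R != 0 :> R[i] by [].
have zw : z * w = 1 by rewrite divff.
have [M HM] := Hres ar; pose K := rnorm w * (1 + rnorm w / a) / a.
have K0 : 0 <= K.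
  case/andP: a01 => a0 _.
  by rewrite divr_ge0 ?(ltW a0)// mulr_ge0 ?rnorm_ge0// addr_ge0// divr_ge0 ?rnorm_ge0// ltW.
have [||S HS] := @seqspace_op R E (resolvent w) (K * M).
- move=> b x y; apply/funext => n.
  exact: (resolvent_linear nC wn b x y n).
- move=> x xE; have [vE vle] := HM x xE.
  have [yE yle] : seqspace_dom E (resolvent w x) /\
      seqspace_norm E (resolvent w x) <=
      seqspace_norm E (K%:C *: realseq (resolvent a (cabs x))).
    apply: (cs_le HE); first exact: seqspace_domZ.
    move=> n; rewrite abs_meanZ rnormC ger0_norm// abs_mean_realseq; last first.
      by move=> k; exact: resolvent_ge0.
    rewrite /mean mulrA ler_wpM2r ?invr_ge0// mulr_sumr.
    by apply: ler_sum => k _; exact: rnorm_resolvent_le.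
  split=> //; apply: le_trans yle _.
  by rewrite seqspace_normZ// rnormC ger0_norm// -mulrA ler_wpM2l.
exists S; split=> [x|x]; apply: val_inj.
  rewrite HS; apply/esym; apply: (resolvent_unique wn) => n.
  rewrite seqspace_valB seqspace_valZ HT subrK mulrA [w * z]mulrC zw mul1r //.
apply/funext => n; rewrite seqspace_valB seqspace_valZ HT HS /Defs.cesaro.
rewrite sum_resolvent// /resolvent mulrA zw mul1r addrK //.
Qed.

End resolvent_operator.

(** * Operator norms and powers of operators *)

Section operator_norm.
Context {R : realType} {V : normedModType R[i]}.
Implicit Types (f : V -> V) (T : bounded_op V) (u : V).

Lemma opnorm_le f (M : R) : 0 <= M -> (forall u, rnorm (f u) <= M * rnorm u) ->
  (opnorm f <= M%:E)%E.
Proof.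
move=> M0 fM; apply: ge_ereal_sup => _ [u /= u1 <-]; rewrite lee_fin.
by apply: le_trans (fM u) _; rewrite ler_piMr.
Qed.

(** Stated for a homogeneous function so as to cover the iterates [iter n T], which are not bundled
    as linear maps. *)
Lemma opnorm_ubound f (M : R) u :
  (forall (a : R[i]) v, f (a *: v) = a *: f v) ->
  (opnorm f <= M%:E)%E -> rnorm (f u) <= M * rnorm u.
Proof.
move=> fZ fM; have [u0|u0] := eqVneq (rnorm u) 0.
  rewrite u0 mulr0 (rnorm0_eq0 u0) -(scale0r (0 : V)) fZ scale0r.
  by rewrite rnorm0.
have u_gt0 : 0 < rnorm u by rewrite lt_neqAle eq_sym u0 rnorm_ge0.
have : ((rnorm (f ((rnorm u)^-1%:C *: u)))%:E <= M%:E)%E.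
  apply: le_trans fM; apply: ereal_sup_ubound; exists ((rnorm u)^-1%:C *: u) => //=.
  by rewrite rnormZ rnormC ger0_norm ?invr_ge0 ?rnorm_ge0// mulVf.
rewrite lee_fin fZ rnormZ rnormC ger0_norm ?invr_ge0 ?rnorm_ge0//.
by rewrite mulrC ler_pdivrMr.
Qed.

Lemma opnorm_ge0 f : f 0 = 0 -> (0 <= opnorm f)%E.
Proof.
move=> f0; apply: ereal_sup_ubound; exists 0 => /=; first by rewrite rnorm0.
by rewrite f0 rnorm0.
Qed.

Lemma iterZ T n (a : R[i]) u : iter n T (a *: u) = a *: iter n T u.
Proof. by elim: n => [//|n IH]; rewrite !iterS IH linearZ. Qed.

Lemma rnorm_iter_le T (M : R) n u : 0 <= M ->
  (forall v, rnorm (T v) <= M * rnorm v) ->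
  rnorm (iter n T u) <= M ^+ n * rnorm u.
Proof.
move=> M0 TM; elim: n => [|n IH]; first by rewrite expr0 mul1r.
by rewrite iterS exprS -mulrA; apply: le_trans (TM _) _; rewrite ler_wpM2l.
Qed.

Lemma contraction_power_bounded T :
  (forall u, rnorm (T u) <= rnorm u) -> power_bounded T.
Proof.
move=> T1; apply: (@le_lt_trans _ _ 1%E); last exact: ltry.
apply: ge_ereal_sup => _ [n _ <-]; apply: opnorm_le => // u.
rewrite -(expr1n _ n); apply: rnorm_iter_le => // v.
by rewrite mul1r.
Qed.

Lemma power_bounded_iter T : power_bounded T ->
  exists2 B, 0 <= B & forall n u, rnorm (iter n T u) <= B * rnorm u.
Proof.
rewrite /power_bounded; set S := ereal_sup _ => Soo.
have TS n : (1 <= n)%N -> (opnorm (iter n T) <= S)%E.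
  by move=> n1; apply: ereal_sup_ubound; exists n.
have [B SB] : exists B : R, (S <= B%:E)%E.
  by case: S Soo {TS} => [r _||_]; [exists r|by []|exists 0; rewrite leNye].
(* The maximum with 1 covers [n = 0], which the supremum leaves out. *)
exists (Num.max B 1); first by rewrite le_max ler01 orbT.
move=> [|n] u; first by rewrite ler_peMl ?rnorm_ge0// le_max lexx orbT.
apply: (@le_trans _ _ (B * rnorm u)).
  apply: opnorm_ubound => [a v|]; first exact: iterZ.
  exact: le_trans (TS n.+1 isT) SB.
by rewrite ler_wpM2r ?rnorm_ge0// le_max lexx.
Qed.

End operator_norm.

Section cesaro_operator_norm.
Context {R : realType} {E : seqspace R} {rho : R}.
Hypothesis HE : cesaro_space E rho.
Hypothesis Hdual : forall s, rho^-1 < s ->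
  exists2 K, 0 <= K & forall N x, seqspace_dom E x ->
    \sum_(k < N) rnorm (x k) * k.+1%:R `^ (- s) <= K * seqspace_norm E x.
Variables (T : bounded_op E) (HT : is_cesaro_op T).

Let rho0 : 0 < rho. Proof. exact: lt_le_trans ltr01 (cs_rho_ge1 HE). Qed.

(** For [t < l < rho] and [w = 1/l], the iterates are bounded below by a multiple of [l^j], which
    outgrows [B t^j]. Taking [t] to be the operator norm, or 1, yields the next two lemmas. *)
Lemma iter_cesaro_op_growth (t B : R) (e : E) : 0 <= t < rho -> 0 <= B ->
  val e = delta 0 -> ~ (forall j, rnorm (iter j T e) <= B * t ^+ j).
Proof.
move=> /andP[t0 tr] B0 eE h; pose l := (t + rho) / 2.
have tl : t < l by rewrite /l; lra.
have lr : l < rho by rewrite /l; lra.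
have l0 : 0 < l by lra.
have rw : rho^-1 < complex.Re (l^-1)%:C by rewrite /= ltf_pV2.
have [K HK] := iter_cesaro_op_lower HE Hdual HT rw eE.
apply: (@geometric_absurd R (`|K| * B) 1 (t / l)).
  by rewrite divr_ge0 ?(ltW l0)//= ltr_pdivrMr// mul1r.
move=> j; rewrite expr1n; apply: le_trans (HK j) _.
apply: (@le_trans _ _ (`|K| * (rnorm (l^-1)%:C ^+ j * rnorm (iter j T e)))).
  by rewrite ler_wpM2r ?ler_norm// mulr_ge0 ?exprn_ge0 ?rnorm_ge0.
rewrite rnormC [`|l^-1|]gtr0_norm ?invr_gt0// -mulrA ler_wpM2l// expr_div_n exprVn.
by rewrite [leLHS]mulrC [leRHS]mulrA ler_wpM2r// invr_ge0 exprn_ge0// ltW.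
Qed.

Lemma opnorm_cesaro_op : opnorm T = rho%:E.
Proof.
apply/eqP; rewrite eq_le; apply/andP; split.
  by apply: opnorm_le (rnorm_cesaro_op HE HT); exact: ltW.
rewrite leNgt; apply/negP => Trho.
have T0 : (0 <= opnorm T)%E by apply: opnorm_ge0; rewrite linear0.
have /EFin_fin_numP[r TE] : opnorm T \is a fin_num.
  by rewrite ge0_fin_numE//; apply: lt_trans Trho _; exact: ltry.
rewrite TE lee_fin in T0; rewrite TE lte_fin in Trho.
have [e eE] := seqspace_elt (cs_delta HE 0).
apply: (@iter_cesaro_op_growth r (rnorm e) e) => //; first by rewrite T0.
  exact: rnorm_ge0.
move=> j; rewrite mulrC; apply: rnorm_iter_le => // v.
by apply: opnorm_ubound; [move=> a u; exact: linearZ|rewrite TE].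
Qed.

Lemma cesaro_op_not_power_bounded : 1 < rho -> ~ power_bounded T.
Proof.
move=> r1 /power_bounded_iter[B B0 TB].
have [e eE] := seqspace_elt (cs_delta HE 0).
apply: (@iter_cesaro_op_growth 1 (B * rnorm e) e) => //; first by rewrite ler01.
  by rewrite mulr_ge0 ?rnorm_ge0.
by move=> j; rewrite expr1n mulr1.
Qed.

End cesaro_operator_norm.

Section contractive_cesaro_operator.
Context {R : realType} {E : seqspace R}.
Hypothesis HE : cesaro_space E 1.
Variables (T : bounded_op E) (HT : is_cesaro_op T).

Lemma cesaro_op_contraction_power_bounded : power_bounded T.
Proof.
apply: contraction_power_bounded => u.
by have := rnorm_cesaro_op HE HT u; rewrite mul1r.
Qed.

(** The norm is attained at [e_0], whose image has zeroth coordinate 1. *)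
Lemma opnorm_cesaro_op_contraction : seqspace_norm E (delta 0) <= 1 ->
  opnorm T = 1%E.
Proof.
move=> d1; apply/eqP; rewrite eq_le; apply/andP; split.
  by apply: (@opnorm_le _ _ _ 1) => // u; have := rnorm_cesaro_op HE HT u.
have [e eE] := seqspace_elt (cs_delta HE 0).
apply: (@le_trans _ _ (rnorm (T e))%:E).
  have := cs_coord HE (T e) 0.
  by rewrite HT eE cesaro_delta invr1 mulr1 rnorm1 mul1r lee_fin.
by apply: ereal_sup_ubound; exists e => //=; rewrite rnorm_seqspace eE.
Qed.

End contractive_cesaro_operator.

(** * The space ces_p *)

Section ces_p.
Context {R : realType} (p : R) (p1 : 1 < p).
Implicit Types (x y : nat -> R[i]) (B : R).

Let p0 : 0 < p. Proof. exact: lt_trans ltr01 p1. Qed.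

Let rho := p / (p - 1).

Let rho_gt1 : 1 < rho.
Proof. by rewrite /rho ltr_pdivlMr ?subr_gt0// mul1r; lra. Qed.

Let rho_gt0 : 0 < rho. Proof. exact: lt_trans ltr01 rho_gt1. Qed.

Let powRK B : 0 <= B -> (B `^ p) `^ p^-1 = B.
Proof. by move=> B0; rewrite -powRrM divff ?gt_eqF// powRr1. Qed.

Let powRVK B : 0 <= B -> (B `^ p^-1) `^ p = B.
Proof. by move=> B0; rewrite -powRrM mulVf ?gt_eqF// powRr1. Qed.

Let le_powRp (u v : R) : 0 <= u -> u <= v -> u `^ p <= v `^ p.
Proof.
by move=> u0 uv; apply: ge0_ler_powR; rewrite ?nnegrE ?(ltW p0)// (le_trans u0).
Qed.

Let norm_ge0 x : 0 <= seqspace_norm (ces p1) x.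
Proof. by apply: fine_ge0; exact: ces_norm_ge0. Qed.

(** Together with [sum_powR_le_ces_norm], reduces statements about the extended-real series to
    finite sums. *)
Lemma ces_norm_le x B : 0 <= B ->
  (forall N, \sum_(n < N) abs_mean x n `^ p <= B `^ p) ->
  seqspace_dom (ces p1) x /\ seqspace_norm (ces p1) x <= B.
Proof.
move=> B0 xB; suff h : (ces_norm p x <= B%:E)%E.
  split; first exact: le_lt_trans h (ltry _).
  by rewrite -lee_fin fineK// ge0_fin_numE ?ces_norm_ge0// (le_lt_trans h)// ltry.
have S : (\sum_(0 <= n <oo) (abs_mean x n `^ p)%:E <= (B `^ p)%:E)%E.
  apply: lime_le.
    by apply: is_cvg_nneseries => n _ _; rewrite lee_fin powR_ge0.
  by apply: nearW => N; rewrite big_mkord sumEFin lee_fin.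
rewrite /ces_norm -[in leRHS](powRK B0) -poweR_EFin.
apply: gt0_ler_poweR => //.
- by rewrite invr_ge0 ltW.
- by rewrite in_itv /= leey ces_norm_sum_ge0.
- by rewrite in_itv /= leey lee_fin powR_ge0.
Qed.

Lemma sum_powR_le_ces_norm x N : seqspace_dom (ces p1) x ->
  \sum_(n < N) abs_mean x n `^ p <= seqspace_norm (ces p1) x `^ p.
Proof.
move=> /= xoo.
have xf : ces_norm p x \is a fin_num by rewrite ge0_fin_numE ?ces_norm_ge0.
set S := \sum_(n < N) _; have S0 : 0 <= S by apply: sumr_ge0 => n _; exact: powR_ge0.
rewrite -(powRVK S0); apply: le_powRp; first exact: powR_ge0.
rewrite -lee_fin fineK// -poweR_EFin; apply: gt0_ler_poweR => //.
- by rewrite invr_ge0 ltW.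
- by rewrite in_itv /= leey lee_fin S0.
- by rewrite in_itv /= leey ces_norm_sum_ge0.
rewrite /S -sumEFin -(big_mkord xpredT (fun n => (abs_mean x n `^ p)%:E)).
by apply: nneseries_lim_ge => n _ _; rewrite lee_fin powR_ge0.
Qed.

Lemma cesaro_space_ces : cesaro_space (ces p1) rho.
Proof.
split; first exact: ltW.
- move=> x y f fh yE xy; apply: ces_norm_le => // N.
  apply: le_trans (sum_powR_le_ces_norm (f N) yE).
  apply: le_trans (sum_subseq_le (a := fun n => abs_mean y n `^ p) N _ fh).
    by apply: ler_sum => n _; apply: le_powRp => //; exact: abs_mean_ge0.
  by move=> k; exact: powR_ge0.
- move=> k; have [K HK] := sum_powRN_le p1.
  have K0 : 0 <= K by have := HK 0%N; rewrite big_ord0.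
  suff [] : seqspace_dom (ces p1) (delta k) /\
    seqspace_norm (ces p1) (delta k) <= K `^ p^-1 by [].
  apply: ces_norm_le => [|N]; first exact: powR_ge0.
  rewrite powRVK//; apply: le_trans (HK N); apply: ler_sum => n _.
  rewrite abs_mean_delta; case: leqP => _; last by rewrite mul0r powR0 ?powR_ge0// gt_eqF.
  by rewrite mul1r -powR_inv1// -powRrM mulN1r.
- move=> x n xE; rewrite -(powRK (abs_mean_ge0 x n)) -[leRHS](powRK (norm_ge0 x)).
  apply: ge0_ler_powR; rewrite ?nnegrE ?powR_ge0 ?invr_ge0 ?(ltW p0)//.
  apply: le_trans (sum_powR_le_ces_norm n.+1 xE).
  by rewrite big_ord_recr/= lerDr sumr_ge0// => k _; exact: powR_ge0.
- move=> x xE; have rho0 := ltW rho_gt0.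
  apply: ces_norm_le => [|N]; first exact: mulr_ge0.
  rewrite powRM//; apply: le_trans (ler_wpM2l (powR_ge0 _ _) (sum_powR_le_ces_norm N xE)).
  apply: le_trans (hardy N p1 (abs_mean_ge0 x)).
  apply: ler_sum => n _; apply: le_powRp; first exact: abs_mean_ge0.
  exact: abs_mean_cesaro_le.
Qed.

(** After [weighted_sum_le], Young's inequality for the conjugate exponents [p] and [rho], applied
    to the means divided by the norm [r], plays the part of Hölder's. The weights are summable
    because [s * rho > 1]. *)
Lemma ces_dual s : rho^-1 < s ->
  exists2 K, 0 <= K & forall N x, seqspace_dom (ces p1) x ->
    \sum_(k < N) rnorm (x k) * k.+1%:R `^ (- s) <=
    K * seqspace_norm (ces p1) x.
Proof.
move=> rs; have rho0 := rho_gt0.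
have s0 : 0 < s by apply: lt_trans rs; rewrite invr_gt0.
have srho : 1 < s * rho by rewrite -ltr_pdivrMr// div1r.
have [D HD] := sum_powRN_le srho.
have D0 : 0 <= D by have := HD 0%N; rewrite big_ord0.
have K0 : 0 <= p^-1 + D / rho.
  apply: addr_ge0; first by rewrite invr_ge0 ltW.
  exact: divr_ge0 D0 (ltW rho0).
exists (2 `^ (s + 1) * (p^-1 + D / rho)).
  by rewrite mulr_ge0// powR_ge0.
move=> N x xE; set r := seqspace_norm _ x.
have r0 : 0 <= r by exact: norm_ge0.
apply: le_trans (weighted_sum_le N (fun k => rnorm_ge0 (x k)) s0) _.
rewrite -mulrA ler_wpM2l ?powR_ge0// -[mean _]/(abs_mean x).
have [r00|rn0] := eqVneq r 0.
  rewrite big1 ?r00 ?mulr0// => n _; rewrite (seqspace_norm_eq0 xE r00).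
  by rewrite abs_mean0 mul0r.
have r_gt0 : 0 < r by rewrite lt_neqAle eq_sym rn0.
rewrite -ler_pdivrMr// mulr_suml.
apply: (@le_trans _ _ (\sum_(n < N.*2) (r `^ (- p) / p * abs_mean x n `^ p +
    n.+1%:R `^ (- (s * rho)) / rho))).
  apply: ler_sum => n _; rewrite mulrAC.
  have An : 0 <= abs_mean x n / r by rewrite divr_ge0 ?abs_mean_ge0.
  apply: le_trans (conjugate_powR (q := rho) An (powR_ge0 _ _) p0 rho0 _) _.
    by rewrite /rho invf_div; field; rewrite gt_eqF.
  rewrite -powRrM mulNr powRM ?abs_mean_ge0 ?invr_ge0// -powR_inv1// -powRrM mulN1r.
  by rewrite lerD2r le_eqVlt; apply/orP; left; apply/eqP; ring.
rewrite big_split/= -mulr_sumr -mulr_suml lerD//; last first.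
  by apply: ler_wpM2r (HD _); rewrite invr_ge0 ltW.
apply: le_trans (ler_wpM2l _ (sum_powR_le_ces_norm _ xE)) _.
  by rewrite divr_ge0 ?powR_ge0// ltW.
by rewrite -/r mulrAC powRN mulVf ?mul1r// gt_eqF// powR_gt0.
Qed.

(** The first [N] means of [v] and of [trunc N v] coincide, so the uniform bound on the truncations
    bounds every partial sum. *)
Lemma ces_resolvent a : 0 < a < rho^-1 -> exists M, forall x,
  seqspace_dom (ces p1) x ->
  seqspace_dom (ces p1) (realseq (resolvent a (cabs x))) /\
  seqspace_norm (ces p1) (realseq (resolvent a (cabs x))) <=
  M * seqspace_norm (ces p1) x.
Proof.
move=> ar; exists (a / (1 - a * rho)) => x xE.
have h N := seqspace_norm_trunc_resolvent cesaro_space_ces N ar xE.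
apply: ces_norm_le => [|N]; first exact: le_trans (h 0%N).
set v := realseq _; apply: (@le_trans _ _ (\sum_(n < N) abs_mean (trunc N v) n `^ p)).
  apply: ler_sum => n _; rewrite le_eqVlt; apply/orP; left; apply/eqP.
  congr (_ `^ p); rewrite /abs_mean; congr (_ / _); apply: eq_bigr => k _.
  by rewrite /trunc ifT// (leq_ltn_trans _ (ltn_ord n))// -ltnS.
apply: le_trans (sum_powR_le_ces_norm N _) _.
  exact: seqspace_dom_trunc cesaro_space_ces N v.
by apply: le_powRp (h N).
Qed.

Lemma ces_const1 : ~ seqspace_dom (ces p1) (fun=> 1).
Proof.
move=> oneE; pose r := seqspace_norm (ces p1) (fun=> 1) `^ p.
have := sum_powR_le_ces_norm (Num.bound r) oneE; rewrite -/r.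
have := archi_boundP (powR_ge0 _ _ : 0 <= r) => rb.
apply/negP; rewrite -ltNge; apply: lt_le_trans rb _.
rewrite -[in leLHS](card_ord (Num.bound r)) -sumr_const; apply: ler_sum => n _.
rewrite (_ : abs_mean _ n = 1) ?powR1// -[RHS](mean_cst 1 n).
by rewrite /abs_mean rnorm1.
Qed.

Lemma cesaro_op_ces : exists T : bounded_op (ces p1),
  is_cesaro_op T /\
  opnorm T = rho%:E /\
  spectrum T = [set z | `|z - (rho / 2)%:C| <= (rho / 2)%:C] /\
  ~ compact_op T /\
  ~ power_bounded T /\
  ~ mean_ergodic T /\
  ~ supercyclic T.
Proof.
have HE := cesaro_space_ces; have [T HT] := cs_op HE.
exists T; split=> //; split; first exact: opnorm_cesaro_op HE ces_dual _ HT.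
split.
  apply/seteqP; split; first exact: spectrum_sub_disc HE ces_resolvent _ HT.
  exact: disc_sub_spectrum HE ces_dual _ HT.
split; first exact: cesaro_op_not_compact HE _ HT.
split; first exact: cesaro_op_not_power_bounded HE ces_dual _ HT rho_gt1.
split; last exact: cesaro_op_not_supercyclic HE _ HT.
have [e eE] := seqspace_elt (cs_delta HE 0).
move=> /(mean_ergodic_limit HE HT eE)[y yE _]; apply: ces_const1.
by rewrite -yE; exact: seqspace_valP.
Qed.

End ces_p.

(** * The spaces ces_0 and ces_oo *)

Section ces_sup.
Context {R : realType}.
Implicit Types (x y : nat -> R[i]) (B : R).

Notation norm_oo := (seqspace_norm (ces_oo : seqspace R)).

Lemma ces_oo_le x B : (forall n, abs_mean x n <= B) ->
  seqspace_dom (ces_oo : seqspace R) x /\ norm_oo x <= B.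
Proof.
move=> xB; suff h : (ces_oo_norm x <= B%:E)%E.
  split; first exact: le_lt_trans h (ltry _).
  by rewrite -lee_fin fineK// ge0_fin_numE ?ces_oo_norm_ge0// (le_lt_trans h)// ltry.
by apply: ge_ereal_sup => _ [n _ <-]; rewrite lee_fin.
Qed.

Lemma abs_mean_le_norm_oo x n : seqspace_dom (ces_oo : seqspace R) x ->
  abs_mean x n <= norm_oo x.
Proof.
move=> xE; rewrite -lee_fin fineK ?abs_mean_le_ces_oo//.
by rewrite ge0_fin_numE ?ces_oo_norm_ge0.
Qed.

Lemma abs_mean_delta_le k n : abs_mean (delta k : nat -> R[i]) n <= n.+1%:R^-1.
Proof.
by rewrite abs_mean_delta ler_piMl// lern1 leq_b1.
Qed.

Lemma norm_oo_delta_le1 k : norm_oo (delta k) <= 1.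
Proof.
apply: (ces_oo_le _).2 => n; apply: le_trans (abs_mean_delta_le k n) _.
by rewrite invf_le1// ler1n.
Qed.

Lemma norm_oo_cesaro x : seqspace_dom (ces_oo : seqspace R) x ->
  seqspace_dom (ces_oo : seqspace R) (Defs.cesaro x) /\
  norm_oo (Defs.cesaro x) <= 1 * norm_oo x.
Proof.
move=> xE; rewrite mul1r; apply: ces_oo_le => n.
apply: le_trans (abs_mean_cesaro_le x n) _.
rewrite -[leRHS](mean_cst _ n); apply: le_mean => k _.
exact: abs_mean_le_norm_oo.
Qed.

Lemma cesaro_space_ces_oo : cesaro_space (ces_oo : seqspace R) 1.
Proof.
split=> //.
- move=> x y f _ yE xy; apply: ces_oo_le => n.
  exact: le_trans (xy n) (abs_mean_le_norm_oo _ yE).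
- move=> k; apply: (ces_oo_le (B := 1) _).1 => n.
  apply: le_trans (abs_mean_delta_le k n) _.
  by rewrite invf_le1// ler1n.
- by move=> x n; exact: abs_mean_le_norm_oo.
- exact: norm_oo_cesaro.
Qed.

Lemma squeeze0 (u v : nat -> R) : (forall n, 0 <= u n <= v n) ->
  v @ \oo --> (0 : R) -> u @ \oo --> (0 : R).
Proof.
move=> uv v0; apply: (squeeze_cvgr _ (cvg_cst 0) v0).
by exists 0%N => // n _; exact: uv.
Qed.

Lemma cesaro_space_ces_0 : cesaro_space (ces_0 : seqspace R) 1.
Proof.
split=> //.
- move=> x y f fh [yE y0] xy.
  have [xE xle] : seqspace_dom (ces_oo : seqspace R) x /\ norm_oo x <= norm_oo y.
    by apply: (cs_solid cesaro_space_ces_oo fh).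
  split=> //; split=> //; apply: squeeze0 (fun n => abs_mean y (f n)) _ _.
    by move=> n; rewrite abs_mean_ge0 xy.
  have fn n : (n <= f n)%N.
    by elim: n => // n IH; apply: leq_ltn_trans IH _; exact: fh.
  move=> A /y0[N _ NA]; exists N => // n /= nN; apply: NA => /=.
  exact: leq_trans nN (fn n).
- move=> k; split; first exact: cs_delta cesaro_space_ces_oo k.
  apply: squeeze0 (fun n => n.+1%:R^-1) _ _.
    by move=> n; rewrite abs_mean_ge0 abs_mean_delta_le.
  exact: cvg_harmonic.
- by move=> x n [xE _]; exact: abs_mean_le_norm_oo.
- move=> x [xE x0]; have [CE Cle] := norm_oo_cesaro xE.
  split=> //; split=> //; apply: squeeze0 (mean (abs_mean x)) _ _.
    by move=> n; rewrite abs_mean_ge0 abs_mean_cesaro_le.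
  exact: cvg_mean.
Qed.

(** After [weighted_sum_le], each mean is at most the norm, and the weights are summable for
    [s > 1]. *)
Lemma ces_0_dual (s : R) : 1^-1 < s ->
  exists2 K, 0 <= K & forall N x, seqspace_dom (ces_0 : seqspace R) x ->
    \sum_(k < N) rnorm (x k) * k.+1%:R `^ (- s) <=
    K * seqspace_norm (ces_0 : seqspace R) x.
Proof.
rewrite invr1 => s1; have s0 : 0 < s by lra.
have [D HD] := sum_powRN_le s1.
have D0 : 0 <= D by have := HD 0%N; rewrite big_ord0.
exists (2 `^ (s + 1) * D) => [|N x xE]; first by rewrite mulr_ge0// powR_ge0.
apply: le_trans (weighted_sum_le N (fun k => rnorm_ge0 (x k)) s0) _.
rewrite -mulrA ler_wpM2l ?powR_ge0// -[mean _]/(abs_mean x).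
have r0 : 0 <= seqspace_norm (ces_0 : seqspace R) x.
  by apply: fine_ge0; exact: ces_oo_norm_ge0.
apply: le_trans (ler_wpM2r r0 (HD N.*2)); rewrite mulr_suml.
apply: ler_sum => n _; rewrite mulrC ler_wpM2l ?powR_ge0//.
exact: abs_mean_le_norm_oo xE.1.
Qed.

(* Iterating the recursion, [A] is at most a null sequence plus [B a^j]. *)
Lemma mean_recursion_cvg0 (a B : R) (A c : nat -> R) : 0 < a < 1 ->
  (forall n, 0 <= A n <= B) -> c @ \oo --> (0 : R) ->
  (forall n, A n = a * (c n + mean A n)) -> A @ \oo --> (0 : R).
Proof.
move=> /andP[a0 a1] AB c0 AE.
have step j : exists2 u : nat -> R, u @ \oo --> (0 : R) &
    forall n, A n <= u n + B * a ^+ j.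
  elim: j => [|j [u u0 Au]].
    exists (cst 0) => [|n]; first exact: cvg_cst.
    by rewrite expr0 mulr1 /= add0r; have /andP[] := AB n.
  exists (fun n => a * (c n + mean u n)) => [|n].
    rewrite -(mulr0 a) -[X in a * X](addr0 0).
    by apply: cvgMl_tmp; apply: cvgD => //; exact: cvg_mean.
  rewrite AE exprS mulrCA -mulrDr ler_wpM2l ?(ltW a0)// -addrA lerD2l.
  rewrite -[X in _ + X](mean_cst _ n) -mulrDl -big_split/=.
  by apply: (@le_mean _ A (fun k => u k + B * a ^+ j)).
apply/cvgrPdist_lt => e e0.
have q1 : `|a| < 1 by rewrite gtr0_norm.
have e2 : 0 < e / 2 by rewrite divr_gt0.
have /cvgrPdist_lt/(_ _ e2)[j _ /(_ j (leqnn _))] := cvg_geometric B q1.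
rewrite /= sub0r normrN => /(le_lt_trans (ler_norm _)) Bj.
have [u /cvgrPdist_lt/(_ _ e2)[N _ NP] Au] := step j.
exists N => // n nN; have := NP n nN; have /andP[An _] := AB n.
rewrite !sub0r !normrN [`|A n|]ger0_norm// => /(le_lt_trans (ler_norm _)) un.
by have := Au n; lra.
Qed.

(** Boundedness comes from the truncations. For the limit, averaging [v = a (|x| + C v)] shows that
    [A = mean v] satisfies [A = a (abs_mean x + mean A)], where [abs_mean x] is a null sequence. *)
Lemma ces_0_resolvent (a : R) : 0 < a < 1^-1 -> exists M, forall x,
  seqspace_dom (ces_0 : seqspace R) x ->
  seqspace_dom (ces_0 : seqspace R) (realseq (resolvent a (cabs x))) /\
  seqspace_norm (ces_0 : seqspace R) (realseq (resolvent a (cabs x))) <=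
  M * seqspace_norm (ces_0 : seqspace R) x.
Proof.
move=> ar; have a01 : 0 < a < 1 by rewrite invr1 in ar.
have /andP[a0 a1] := a01.
exists (a / (1 - a * 1)) => x xE.
have h N := seqspace_norm_trunc_resolvent cesaro_space_ces_0 N ar xE.
set v := resolvent a (cabs x) in h *; set B := _ * seqspace_norm _ _ in h *.
have v0 k : 0 <= v k by exact: resolvent_ge0.
have vB n : abs_mean (realseq v) n <= B.
  apply: le_trans (h n.+1).
  have -> : abs_mean (realseq v) n = abs_mean (trunc n.+1 (realseq v)) n.
    rewrite /abs_mean; congr (_ / _); apply: eq_bigr => k _.
    by rewrite /trunc ltn_ord.
  apply: cs_abs_mean_le cesaro_space_ces_0 _ _ _.
  exact: seqspace_dom_trunc cesaro_space_ces_0 _ _.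
have [vE vle] := ces_oo_le vB; split=> //; split=> //.
rewrite abs_mean_realseq// in vB *; apply: (@mean_recursion_cvg0 a B _ (abs_mean x)) => //.
- by move=> n; rewrite mean_ge0// vB.
- by case: xE.
move=> n; rewrite {1}/mean [in RHS]/mean [in RHS]/abs_mean -mulrDl -big_split/=.
rewrite mulrA mulr_sumr; congr (_ / _); apply: eq_bigr => k _.
rewrite {1}/v /resolvent -sum_resolvent// => m.
by rewrite gt_eqF// resolvent_factor_gt0.
Qed.

(* An eigenvector with first nonzero coordinate [m] has eigenvalue [1/(m+1)],
   and then [(n+1-m) x_{n+1} = (n+1) x_n] for [n >= m]. *)
Lemma cesaro_eigenvector_lower x (z : R[i]) : x <> 0 ->
  Defs.cesaro x = z *: x ->
  exists2 m, x m != 0 & forall n, (m <= n)%N -> rnorm (x m) <= rnorm (x n).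
Proof.
move=> x0 xz.
have ex : exists m, x m != 0.
  apply/not_existsP => h; apply: x0; apply/funext => k.
  by apply/eqP/negPn/negP; exact: h.
case: (ex_minnP ex) => m xm minm; exists m => //.
have S n : \sum_(k < n.+1) x k = n.+1%:R * (z * x n).
  have := congr1 (@^~ n) xz; rewrite /Defs.cesaro => h.
  have -> : z * x n = (\sum_(k < n.+1) x k) / n.+1%:R by rewrite h.
  by rewrite mulrC divfK.
have z1 : m.+1%:R * z = 1.
  apply: (mulIf xm); rewrite mul1r -mulrA -S big_ord_recr/= big1 ?add0r// => k _.
  by apply/eqP/negPn/negP => /minm; rewrite leqNgt ltn_ord.
have rec n : n.+2%:R * x n.+1 = n.+1%:R * x n + m.+1%:R * x n.+1.
  transitivity (m.+1%:R * (n.+2%:R * (z * x n.+1))).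
    by rewrite -[LHS]mul1r -{1}z1; ring.
  rewrite -S big_ord_recr/= S.
  transitivity (m.+1%:R * z * (n.+1%:R * x n) + m.+1%:R * x n.+1); first ring.
  by rewrite z1 mul1r.
elim=> [|n IH]; first by rewrite leqn0 => /eqP ->.
rewrite leq_eqVlt => /predU1P[->//|mn]; apply: le_trans (IH mn) _.
have nm : n.+1%:R * x n = (n.+1 - m)%:R * x n.+1.
  have -> : (n.+1 - m = n.+2 - m.+1)%N by rewrite subSS.
  by rewrite natrB ?mulrBl ?rec ?addrK//; lia.
have := congr1 (@rnorm _ _) nm; rewrite !rnormM !rnorm_nat => nm'.
rewrite -(ler_pM2l (ltr0Sn R n)) nm' ler_wpM2r ?rnorm_ge0// ler_nat.
exact: leq_subr.
Qed.

(** From [m] on the coordinates of an eigenvector have modulus at least [|x_m|]. For [n >= 2 m]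
    these are at least half of the first [n + 1], so the means stay above [|x_m| / 2]. *)
Lemma ces_0_point_spectrum (T : bounded_op (ces_0 : seqspace R)) :
  is_cesaro_op T -> point_spectrum T = set0.
Proof.
move=> HT; apply/seteqP; split=> // z [u u0 Tu].
have [||m xm xn] := @cesaro_eigenvector_lower (val u) z.
- by move=> uE; move/eqP: u0; apply; exact: val_inj.
- by rewrite -HT Tu.
have [_ u_cvg] := seqspace_valP u.
have xm0 : 0 < rnorm (val u m) / 2 by rewrite divr_gt0// rnorm_gt0.
have /cvgrPdist_lt/(_ _ xm0)[N _ NP] := u_cvg.
have := NP (maxn N (m.*2)) (leq_maxl _ _); set n := maxn _ _.
rewrite sub0r normrN ger0_norm ?abs_mean_ge0// ltNge => /negP; apply.
have mn : (m.*2 <= n)%N by exact: leq_maxr.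
rewrite /abs_mean ler_pdivlMr//.
rewrite -(big_mkord xpredT (fun k => rnorm (val u k))) (@big_cat_nat _ _ _ m)//=; last by lia.
apply: ler_wpDl; first by apply: sumr_ge0 => k _; exact: rnorm_ge0.
apply: (@le_trans _ _ (\sum_(m <= k < n.+1) rnorm (val u m))).
  rewrite big_const_nat iter_addr addr0 -[leRHS]mulr_natr -mulrA ler_wpM2l ?rnorm_ge0//.
  by rewrite mulrC ler_pdivrMr// -natrM ler_nat; lia.
by apply: ler_sum_nat => k /andP[mk _]; exact: xn.
Qed.

Lemma ces_0_const1 : ~ seqspace_dom (ces_0 : seqspace R) (fun=> 1).
Proof.
move=> [_ /cvgrPdist_lt/(_ 1 ltr01)[N _ /(_ N (leqnn _))]].
rewrite sub0r normrN ger0_norm ?abs_mean_ge0//.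
rewrite (_ : abs_mean _ N = 1) ?ltxx// -[RHS](mean_cst 1 N).
by rewrite /abs_mean rnorm1.
Qed.

Lemma cesaro_op_ces_0 : exists T : bounded_op (ces_0 : seqspace R),
  is_cesaro_op T /\
  opnorm T = 1%E /\
  power_bounded T /\
  point_spectrum T = set0 /\
  spectrum T = [set z | `|z - (1 / 2 : R)%:C| <= (1 / 2 : R)%:C] /\
  ~ compact_op T /\
  ~ mean_ergodic T /\
  ~ supercyclic T.
Proof.
have HE := cesaro_space_ces_0; have [T HT] := cs_op HE.
exists T; split=> //; split.
  exact: opnorm_cesaro_op_contraction HE _ HT (norm_oo_delta_le1 0).
split; first exact: cesaro_op_contraction_power_bounded HE _ HT.
split; first exact: ces_0_point_spectrum.
split.
  apply/seteqP; split; first exact: spectrum_sub_disc HE ces_0_resolvent _ HT.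
  exact: disc_sub_spectrum HE ces_0_dual _ HT.
split; first exact: cesaro_op_not_compact HE _ HT.
split; last exact: cesaro_op_not_supercyclic HE _ HT.
have [e eE] := seqspace_elt (cs_delta HE 0).
move=> /(mean_ergodic_limit HE HT eE)[y yE _]; apply: ces_0_const1.
by rewrite -yE; exact: seqspace_valP.
Qed.

(* The means [T_[n] e_0] lie in the closed subspace [ces_0], which does not
   contain their only possible limit, the constant sequence 1. *)
Lemma ces_oo_not_mean_ergodic (T : bounded_op (ces_oo : seqspace R)) :
  is_cesaro_op T -> ~ mean_ergodic T.
Proof.
move=> HT; have HE := cesaro_space_ces_oo.
have [e eE] := seqspace_elt (cs_delta HE 0).
move=> /(mean_ergodic_limit HE HT eE)[y yE /(_ 2^-1)[|n]]; first by rewrite invr_gt0.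
set a := ergodic_mean T n e => ya.
have [_ a0] : seqspace_dom (ces_0 : seqspace R) (val a).
  have itE m : seqspace_dom (ces_0 : seqspace R) (val (iter m T e)).
    elim: m => [|m IH]; first by rewrite eE; exact: cs_delta cesaro_space_ces_0 0%N.
    by rewrite iterS HT; exact: (cs_cesaro cesaro_space_ces_0 IH).1.
  apply: (@seqspace_domZ _ (ces_0 : seqspace R)).
  elim/big_rec: _ => [|m u _ IH]; first exact: seqspace_dom0.
  exact: seqspace_domD.
have h2 : 0 < 2^-1 :> R by rewrite invr_gt0.
have /cvgrPdist_lt/(_ _ h2)[N _ /(_ N (leqnn _))] := a0.
rewrite sub0r normrN ger0_norm ?abs_mean_ge0// => aN.
have : abs_mean (val y) N <= abs_mean (val (y - a)) N + abs_mean (val a) N.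
  rewrite -{1}(subrK a y); exact: abs_meanD.
have := cs_abs_mean_le HE N (seqspace_valP (y - a)).
rewrite -rnorm_seqspace yE (_ : abs_mean (fun=> 1) N = 1); first lra.
by rewrite -[RHS](mean_cst 1 N) /abs_mean rnorm1.
Qed.

(* Diagonal argument: a 0-1 sequence, constant on each dyadic block
   [2^j, 2^(j+1)), which on the j-th block is far from the j-th element of the
   given countable set. *)
Lemma ces_oo_not_separable : ~ separable (ces_oo : seqspace R).
Proof.
move=> [D /countable_injP[g ginj] dD].
(* [d] inverts the injection [g] on [D], with default 0 at indices that [g] does not attain. *)
pose d j : ces_oo := xget 0 [set u | D u /\ g u = j].
have dE u : D u -> d (g u) = u.
  move=> Du; rewrite /d; case: xgetP => [v _ [Dv gv]|/(_ u)]; last by case.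
  by apply: ginj; rewrite ?inE.
pose b j : R := \sum_(2 ^ j <= k < 2 ^ j.+1) rnorm (val (d j) k).
(* The entry on block [j] is 1 exactly when the moduli of [d j] sum there to less than half the
   block length. Either way [x - d j] has modulus sum at least [2^j / 2] on the block, hence mean at
   least [1/4] over the first [2^(j+1)] indices. *)
pose s j : bool := b j < (2 ^ j)%:R / 2.
pose x k : R[i] := (s (trunc_log 2 k))%:R.
have [xE _] : seqspace_dom (ces_oo : seqspace R) x /\ norm_oo x <= 1.
  apply: ces_oo_le => n; rewrite -[leRHS](mean_cst 1 n).
  apply: (@le_mean _ (fun k => rnorm (x k)) (fun=> 1)) => k _.
  by rewrite rnorm_nat lern1 leq_b1.
have [u uE] := seqspace_elt xE.
have [|v Dv uv] := @dense_rnorm _ _ D u 4^-1 dD; first by rewrite invr_gt0.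
pose j := g v; have dj : d j = v by exact: dE.
have j0 : (0 < 2 ^ j.+1)%N by rewrite expn_gt0.
have := cs_abs_mean_le cesaro_space_ces_oo (2 ^ j.+1).-1 (seqspace_valP (u - v)).
rewrite -rnorm_seqspace => /le_lt_trans/(_ uv).
rewrite /abs_mean prednK// ltr_pdivrMr ?ltr0n//; apply/negP; rewrite -leNgt.
rewrite -(big_mkord xpredT (fun k => rnorm (val (u - v) k))).
have jj : (2 ^ j <= 2 ^ j.+1)%N by rewrite leq_exp2l.
rewrite (@big_cat_nat _ _ _ (2 ^ j))//.
apply: ler_wpDl; first by apply: sumr_ge0 => k _; exact: rnorm_ge0.
have -> : 4^-1 * (2 ^ j.+1)%:R = (2 ^ j)%:R / 2 :> R.
  by rewrite expnS natrM; field.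
have xk k : (2 ^ j <= k < 2 ^ j.+1)%N -> val (u - v) k = (s j)%:R - val v k.
  by move=> kj; rewrite seqspace_valB uE /x (trunc_log_eq _ kj).
have [sj|sj] := boolP (s j).
  apply: (@le_trans _ _ (\sum_(2 ^ j <= k < 2 ^ j.+1) (1 - rnorm (val v k)))).
    rewrite sumrB big_const_nat iter_addr addr0 -/j.
    have -> : (2 ^ j.+1 - 2 ^ j = 2 ^ j)%N by rewrite expnS mul2n -addnn addnK.
    by move: sj; rewrite /s /b dj; lra.
  apply: ler_sum_nat => k kj; rewrite xk// sj lerBlDr -rnorm1.
  exact: rnorm_le_dist.
apply: (@le_trans _ _ (b j)); first by rewrite leNgt.
rewrite /b dj; apply: ler_sum_nat => k kj.
by rewrite xk// (negbTE sj) sub0r rnormN.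
Qed.

Lemma cesaro_op_ces_oo : exists T : bounded_op (ces_oo : seqspace R),
  is_cesaro_op T /\
  opnorm T = 1%E /\
  power_bounded T /\
  ~ compact_op T /\
  ~ mean_ergodic T /\
  ~ separable (ces_oo : seqspace R) /\
  ~ supercyclic T.
Proof.
have HE := cesaro_space_ces_oo; have [T HT] := cs_op HE.
exists T; split=> //; split.
  exact: opnorm_cesaro_op_contraction HE _ HT (norm_oo_delta_le1 0).
split; first exact: cesaro_op_contraction_power_bounded HE _ HT.
split; first exact: cesaro_op_not_compact HE _ HT.
split; first exact: ces_oo_not_mean_ergodic.
split; first exact: ces_oo_not_separable.
exact: cesaro_op_not_supercyclic HE _ HT.
Qed.

End ces_sup.

Theorem proposition8p1 (R : realType) :
  (forall (p : R) (p1 : 1 < p), let p' := p / (p - 1) in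
     exists T : bounded_op (ces p1),
       is_cesaro_op T /\
       opnorm T = p'%:E /\
       spectrum T = [set z | `|z - (p' / 2)%:C| <= (p' / 2)%:C] /\
       ~ compact_op T /\
       ~ power_bounded T /\
       ~ mean_ergodic T /\
       ~ supercyclic T) /\
  (exists T : bounded_op (ces_0 : seqspace R),
       is_cesaro_op T /\
       opnorm T = 1%E /\
       power_bounded T /\
       point_spectrum T = set0 /\
       spectrum T = [set z | `|z - (1 / 2 : R)%:C| <= (1 / 2 : R)%:C] /\
       ~ compact_op T /\
       ~ mean_ergodic T /\
       ~ supercyclic T) /\
  (exists T : bounded_op (ces_oo : seqspace R),
       is_cesaro_op T /\
       opnorm T = 1%E /\
       power_bounded T /\
       ~ compact_op T /\
       ~ mean_ergodic T /\
       ~ separable (ces_oo : seqspace R) /\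
       ~ supercyclic T).

Proof.
split=> [p p1|]; first exact: cesaro_op_ces.
by split; [exact: cesaro_op_ces_0|exact: cesaro_op_ces_oo].
Qed.
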